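(* Let $\Phi$, $a$, $\bar y_\kappa$ ($\kappa>0$) and $y_0$ be as described in the context. There exist constants $\delta_1>0$, $C>0$ and $\kappa_0>0$ such that for all $0<\kappa\le\kappa_0$ and all $s\ge 0$, \[ |\bar y_\kappa(s)-y_0(s)|\le C\kappa^{\delta_1}. \]
   Context: Let $\Phi:\mathbb R\to[0,\infty[$ be measurable with $\Phi(\eta)=0$ for $\eta<0$ and, as $\eta\to0+$, $\Phi(\eta)=C_\Phi\eta^k+\mathrm O(\eta^{k+\delta})$, where $0<k<3/2$, $\delta>0$, $C_\Phi>0$. Put $a=(k+1/2)/2$. Relativistic steady states: define for $y\in\mathbb R$ $g(y)=4\pi e^{3y}\int_0^{1-e^{-y}}\Phi(\eta)(1-\eta)^2\big(e^{2y}(1-\eta)^2-1\big)^{1/2}d\eta$ and $P(y)=\frac{4\pi}{3}e^{y}\int_0^{1-e^{-y}}\Phi(\eta)\big(e^{2y}(1-\eta)^2-1\big)^{3/2}d\eta$ for $y>0$, and $g(y)=P(y)=0$ for $y\le0$. For $\kappa>0$ let $y_\kappa:[0,\infty[\to\mathbb R$ be the (global, unique) solution of $y'(r)=-\frac{1}{1-2m(r)/r}\big(\frac{m(r)}{r^2}+4\pi rP(y(r))\big)$, $y(0)=\kappa$, where $m(r)=4\pi\int_0^r\sigma^2 g(y(\sigma))\,d\sigma$. Define $\bar y_\kappa(s):=\kappa^{-1}y_\kappa(\kappa^{-a}s)$, $s\ge0$. Equivalently, $\bar y_\kappa$ is the solution on $[0,\infty[$ of the rescaled problem \[ \bar y'(s)=-\frac{1}{1-\kappa\frac{2\bar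 m_\kappa(s)}{s}}\Big(\frac{\bar m_\kappa(s)}{s^2}+4\pi\kappa s\,H_\kappa(\bar y(s))\Big),\quad \bar y(0)=1,\quad \bar m_\kappa(s)=4\pi\int_0^s\sigma^2 g_\kappa(\bar y(\sigma))\,d\sigma, \] where: $F_\kappa$ is defined by $e^{-\kappa x}=1-\kappa x+\kappa^2F_\kappa(x)$ for $x\ge0$; $G_\kappa(x,\eta)=\eta^2-F_\kappa(2x)$; $\Phi_\kappa(\eta)=\kappa^{1/2-2a}\Phi(\kappa\eta)$; and for $x>0$ $g_\kappa(x)=4\pi e^{4\kappa x}\int_0^{x-\kappa F_\kappa(x)}\Phi_\kappa(\eta)(1-\kappa\eta)^2\big(2(x-\eta)+\kappa G_\kappa(x,\eta)\big)^{1/2}d\eta$, $H_\kappa(x)=\frac{4\pi}{3}e^{4\kappa x}\int_0^{x-\kappa F_\kappa(x)}\Phi_\kappa(\eta)\big(2(x-\eta)+\kappa G_\kappa(x,\eta)\big)^{3/2}d\eta$, with $g_\kappa(x)=H_\kappa(x)=0$ for $x\le0$. Newtonian limit: $\Phi_0(\eta):=\lim_{\kappa\to0}\Phi_\kappa(\eta)$ (i.e. $C_\Phi\eta^k$ for $\eta>0$, $0$ for $\eta<0$); $g_0(x)=4\pi\sqrt2\int_0^x\Phi_0(\eta)(x-\eta)^{1/2}d\eta$ for $x>0$, $g_0(x)=0$ for $x\le0$; $y_0$ is the solution on $[0,\infty[$ of $y'(r)=-m_0(r)/r^2$, $y(0)=1$, with $m_0(r)=4\pi\int_0^r\sigma^2g_0(y(\sigma))\,d\sigma$.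 *)

(* Defs.v *)
From HB Require Import structures.
From mathcomp Require Import all_boot all_order all_algebra.
From mathcomp Require Import all_classical all_reals all_analysis.
Set Implicit Arguments. Unset Strict Implicit. Unset Printing Implicit Defensive.
Import Order.TTheory GRing.Theory Num.Theory.
Import numFieldNormedType.Exports.
Local Open Scope classical_set_scope.
Local Open Scope ring_scope.

Section Defs.
Variable R : realType.

Local Notation leb := (@lebesgue_measure R).

Definition Rint (a b : R) (f : R -> R) : R := Rintegral leb `[a, b] f.

Definition rel_g (Phi : R -> R) (y : R) : R :=
  if 0 < y then
    4 * pi * expR (3 * y) *
    Rint 0 (1 - expR (- y))
      (fun eta => Phi eta * (1 - eta) ^+ 2 *
                  Num.sqrt (expR (2 * y) * (1 - eta) ^+ 2 - 1))
  else 0.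

Definition rel_P (Phi : R -> R) (y : R) : R :=
  if 0 < y then
    4 * pi / 3 * expR y *
    Rint 0 (1 - expR (- y))
      (fun eta => Phi eta * (Num.sqrt (expR (2 * y) * (1 - eta) ^+ 2 - 1)) ^+ 3)
  else 0.

Definition rel_mass (Phi : R -> R) (y : R -> R) (r : R) : R :=
  4 * pi * Rint 0 r (fun s => s ^+ 2 * rel_g Phi (y s)).

Definition rel_solution (Phi : R -> R) (kappa : R) (y : R -> R) : Prop :=
  y 0 = kappa /\ (y x @[x --> 0^'+] --> kappa) /\
  forall r : R, 0 < r ->
    2 * rel_mass Phi y r / r < 1 /\
    is_derive r 1 y
      (- (1 / (1 - 2 * rel_mass Phi y r / r)) *
         (rel_mass Phi y r / r ^+ 2 + 4 * pi * r * rel_P Phi (y r))).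

Definition Phi0 (CPhi k : R) (eta : R) : R :=
  if 0 < eta then CPhi * eta `^ k else 0.

Definition newt_g (CPhi k : R) (x : R) : R :=
  if 0 < x then
    4 * pi * Num.sqrt 2 * Rint 0 x (fun eta => Phi0 CPhi k eta * Num.sqrt (x - eta))
  else 0.

Definition newt_mass (CPhi k : R) (y : R -> R) (r : R) : R :=
  4 * pi * Rint 0 r (fun s => s ^+ 2 * newt_g CPhi k (y s)).

Definition newt_solution (CPhi k : R) (y : R -> R) : Prop :=
  y 0 = 1 /\ (y x @[x --> 0^'+] --> (1 : R)) /\
  forall r : R, 0 < r -> is_derive r 1 y (- (newt_mass CPhi k y r / r ^+ 2)).

Definition Phi_asymp (Phi : R -> R) (CPhi k delta : R) : Prop :=
  exists M eps : R, 0 < eps /\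
    forall eta, 0 < eta -> eta < eps ->
      `|Phi eta - CPhi * eta `^ k| <= M * eta `^ (k + delta).

End Defs.

(* Main.v *)
(* After the rescaling [u(s) = y(kappa^(-a) s) / kappa], the relativistic and the
   Newtonian problems are integro-differential equations of the same form whose
   densities differ on (-oo, 1] by O(kappa^d), d = min(delta, 1/2), the relativistic
   corrections to the equation being O(kappa). The Newtonian density is
   [gamma x^n] with n = k + 3/2, hence Lipschitz on (-oo, 1], and a weighted maximum
   argument (Gronwall) gives the estimate on every fixed interval [0, S].
   To get a uniform estimate on the half line, one uses that the Newtonian state has
   finite radius: as long as it is positive, y0' <= - c s y0^n gives
   y0(s) <= C s^(-2/(n-1)), and 2/(n-1) > 1 because k < 3/2, whereas y0 > 0 on the
   whole half line would force y0(s) >= m0(1)/s. So y0(S) <= -c < 0 for an S that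
   depends only on gamma and n; for small kappa both functions are negative beyond S,
   where the masses are constant and the slopes differ by O(kappa^d / s^2). *)
Require Import Defs.
From HB Require Import structures.
From mathcomp Require Import all_boot all_order all_algebra.
From mathcomp Require Import all_classical all_reals all_analysis.
From mathcomp Require Import measurable_realfun ring lra.
Import Order.TTheory GRing.Theory Num.Theory.
Import numFieldNormedType.Exports.
Local Open Scope classical_set_scope.
Local Open Scope ring_scope.

(** * Integrals over intervals *)

(** [Phi] is merely measurable, so the relativistic density enters through two properties only: it
    is nondecreasing near 0, and it is close to the Newtonian density. Monotonicity of the density
    and of the solution makes the mass integrand measurable and bounded; the Lipschitz estimate is
    applied to the Newtonian density alone, after inserting its value at the relativistic solution.
    The cap 1/2 in d comes from the square root: the radicand is 2 (y - eta) up to O(y^2), and near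
    a zero of the radicand this shifts the root by O(y), against a root of size y^(1/2). A bound
    y0(S) <= 0 would not transfer to u, which is only close to y0; hence the finite radius argument
    produces an explicit negative margin at S. Margin and constants are closed expressions in the
    data of [Phi], fixed before kappa and the solutions, which is what makes the final estimate
    uniform. Slopes are never integrated: each passage from derivatives to increments is a mean
    value argument against an explicit primitive. *)

Section Rint_theory.
Context {R : realType}.
Local Notation mu := (@lebesgue_measure R).
Local Notation Rint := Defs.Rint.
Implicit Types (a b c r x df : R) (f g : R -> R).

Lemma fine_mu_itv (b0 b1 : bool) a b : a <= b ->
  fine (mu [set` Interval (BSide b0 a) (BSide b1 b)]) = b - a.
Proof.
move=> ab; rewrite lebesgue_measure_itv/= lte_fin.
by case: ltP => //= ba; apply/esym/eqP; rewrite subr_eq0 eq_le ba ab.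
Qed.

Lemma mu_itv_fin (b0 b1 : bool) a b :
  (mu [set` Interval (BSide b0 a) (BSide b1 b)] < +oo)%E.
Proof. by rewrite lebesgue_measure_itv/=; case: ifPn => //; rewrite -EFinB ltry. Qed.

Lemma integrable_itv (b0 b1 : bool) a b f c :
  let D := [set` Interval (BSide b0 a) (BSide b1 b)] in
  measurable_fun D f -> (forall x, D x -> `|f x| <= c) ->
  mu.-integrable D (EFin \o f).
Proof.
move=> /= mf fc; apply: measurable_bounded_integrable => //.
  exact: mu_itv_fin.
exists c; split; first exact: num_real.
by move=> M cM x Dx /=; rewrite (le_trans (fc _ Dx))// ltW.
Qed.

Lemma integrable_cst_itv (b0 b1 : bool) a b c :
  mu.-integrable [set` Interval (BSide b0 a) (BSide b1 b)] (EFin \o (cst c)).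
Proof. by apply: (@integrable_itv _ _ _ _ _ `|c|). Qed.

Lemma Rintegral_itv_le (b0 b1 : bool) a b f c : a <= b ->
  let D := [set` Interval (BSide b0 a) (BSide b1 b)] in
  mu.-integrable D (EFin \o f) -> (forall x, D x -> f x <= c) ->
  Rintegral mu D f <= c * (b - a).
Proof.
move=> ab /= intf fc; rewrite -(fine_mu_itv b0 b1 _ _ ab) -Rintegral_cst//.
by apply: le_Rintegral => //; exact: integrable_cst_itv.
Qed.

Lemma Rintegral_itv_dist (b0 b1 : bool) a b f g c : a <= b ->
  let D := [set` Interval (BSide b0 a) (BSide b1 b)] in
  mu.-integrable D (EFin \o f) -> mu.-integrable D (EFin \o g) ->
  (forall x, D x -> `|f x - g x| <= c) ->
  `|Rintegral mu D f - Rintegral mu D g| <= c * (b - a).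
Proof.
move=> ab /= intf intg fgc; rewrite -RintegralB//.
have ifg : mu.-integrable [set` Interval (BSide b0 a) (BSide b1 b)] (EFin \o (fun x => f x - g x)).
  have -> : EFin \o (fun x => f x - g x) = ((EFin \o f) \- (EFin \o g))%E.
    by apply/funext => x /=; rewrite EFinB.
  exact: integrableB.
apply: (le_trans (le_normr_Rintegral _ _)) => //.
apply: Rintegral_itv_le => //.
have -> : EFin \o (fun x => `|f x - g x|) = abse \o (EFin \o (fun x => f x - g x)).
  by apply/funext.
exact: integrable_abse.
Qed.

Lemma Rintegral_itvZl (b0 b1 : bool) a b f c :
  let D := [set` Interval (BSide b0 a) (BSide b1 b)] in
  mu.-integrable D (EFin \o f) ->
  Rintegral mu D (fun x => c * f x) = c * Rintegral mu D f.
Proof. by move=> /= intf; rewrite RintegralZl. Qed.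

Lemma Rint_ge r a b f c : 0 <= a -> a <= b -> b <= r ->
  mu.-integrable `[0, r] (EFin \o f) ->
  (forall x, 0 <= x <= r -> 0 <= f x) ->
  (forall x, a <= x <= b -> c <= f x) -> c * (b - a) <= Rint 0 r f.
Proof.
move=> a0 ab br intf f0 cf; rewrite -(fine_mu_itv true false _ _ ab) -Rintegral_cst//.
have -> : `[a, b]%classic = `[0, r] `&` `[a, b].
  apply/seteqP; split=> x /=; last by case.
  rewrite !in_itv/= => /andP[ax xb]; by rewrite ax xb (le_trans a0 ax) (le_trans xb br).
rewrite Rintegral_mkcondr; apply: le_Rintegral => //.
  apply: (@integrable_itv _ _ _ _ _ `|c|).
    by apply/measurable_restrict => //; exact: measurable_cst.
  by move=> x _; rewrite patchE; case: ifP => //; rewrite normr0.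
move=> x /=; rewrite in_itv/= => xr; rewrite patchE.
case: ifPn => [|_]; last exact: f0.
by rewrite inE/= in_itv/=; exact: cf.
Qed.

Lemma Rint_homo r b f : r <= b -> mu.-integrable `[0, b] (EFin \o f) ->
  (forall x, 0 <= x <= b -> 0 <= f x) -> Rint 0 r f <= Rint 0 b f.
Proof.
move=> rb intf f0; rewrite /Rint.
have -> : `[0, r]%classic = `[0, b] `&` `[0, r].
  apply/seteqP; split=> x /=; last by case.
  by rewrite !in_itv/= => /andP[x0 xr]; rewrite x0 xr (le_trans xr rb).
rewrite Rintegral_mkcondr; apply: le_Rintegral => //.
  rewrite -restrict_EFin; apply: (integrable_restrict mu _ _ _).1 => //.
  apply: (integrableS _ _ _ intf); [exact: measurable_itv|exact: measurableI|exact: subIsetl].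
move=> x /=; rewrite in_itv/= => xb; rewrite patchE.
by case: ifP => // _; exact: f0.
Qed.

Lemma Rint_eq_tail r b f : r <= b -> (forall x, r < x -> x <= b -> f x = 0) ->
  Rint 0 r f = Rint 0 b f.
Proof.
move=> rb f0; rewrite /Rint Rintegral_mkcond [RHS]Rintegral_mkcond.
congr (Rintegral _ _ _); apply/funext => x; rewrite !patchE !mem_setE !in_itv/=.
have [x0|] //= := leP 0 x; have [xr|rx] := leP x r; first by rewrite (le_trans xr).
by have [xb|] //= := leP x b; rewrite f0.
Qed.

(** The image of Lebesgue measure under multiplication by [c], multiplied by [c], agrees with
    Lebesgue measure on half-open intervals and hence everywhere. Nonnegativity lets the transfer
    formulas apply without integrability. *)
Lemma Rint_scale c r f : 0 < c -> measurable_fun `[0, c * r] f ->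
  (forall x, 0 <= x -> 0 <= f x) ->
  Rint 0 (c * r) f = c * Rint 0 r (fun x => f (c * x)).
Proof.
move=> c0 mf f0; pose T := measurableTypeR R; pose phi (x : T) : T := c * x.
have mphi : measurable_fun [set: T] phi.
  by apply: (@measurable_funM _ _ R setT (cst c) id).
pose nu : {measure set T -> \bar R} :=
  measure_function_pushforward__canonical__measure_function_Measure mu mphi.
have phi_itv (b0 : bool) a b :
    phi @^-1` [set` Interval (BSide b0 a) (BRight b)] = [set` Interval (BSide b0 (a / c)) (BRight (b / c))].
  apply/seteqP; split=> x; case: b0; rewrite /= !in_itv/= ?ltr_pdivrMr// ?ler_pdivrMr//;
    by rewrite ler_pdivlMr// ![x * c]mulrC.
pose c' := NngNum (ltW c0).
have mE A : measurable A -> mu A = mscale c' nu A.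
  apply: lebesgue_measure_unique => _ [[a b] _ <-] /=.
  rewrite /mscale/= /pushforward (phi_itv false).
  rewrite !lebesgue_measure_itv/= !lte_fin ltr_pM2r ?invr_gt0//.
  case: ifPn => _; last by rewrite mule0.
  by rewrite -EFinB -EFinM -mulrBl mulrC divfK// gt_eqF.
rewrite /Rint /Rintegral (@eq_measure_integral _ _ _ _ (mscale c' nu)); last first.
  by move=> A mA _; exact: mE.
rewrite ge0_integral_mscale//=; last 2 first.
- exact/measurable_EFinP.
- by move=> x; rewrite in_itv/= => /andP[x0 _]; rewrite lee_fin f0.
rewrite ge0_integral_pushforward//=; last 2 first.
- exact/measurable_EFinP.
- by move=> x; rewrite inE/= in_itv/= => /andP[x0 _]; rewrite lee_fin f0.
rewrite (phi_itv true) mul0r mulrAC divff ?gt_eqF// mul1r.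
set I := (\int[_]_(_ in _) _)%E.
have : (0 <= I)%E.
  apply: integral_ge0 => x /=; rewrite in_itv/= => /andP[x0 _].
  by rewrite lee_fin f0// mulr_ge0// ltW.
(* If the integral is infinite, [fine] turns both sides into 0. *)
by case: I => [I||] //= _; rewrite gt0_muley ?lte_fin//= mulr0.
Qed.

(** Mean value theorem for [h - f] and [h + f], whose derivatives are nonnegative. It replaces the
    integration of a differential inequality, with no integrability required of the derivatives. *)
Lemma normr_le_increment a b f (df : R -> R) h (dh : R -> R) : a < b ->
  {within `[a, b], continuous f} -> {within `[a, b], continuous h} ->
  (forall x, a < x < b -> is_derive x 1 f (df x)) ->
  (forall x, a < x < b -> is_derive x 1 h (dh x)) ->
  (forall x, a < x < b -> `|df x| <= dh x) ->
  `|f b - f a| <= h b - h a.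
Proof.
move=> ab cf ch Df Dh fh.
have H : forall f' (df' : R -> R), {within `[a, b], continuous f'} -> 
    (forall x, a < x < b -> is_derive x 1 f' (df' x)) ->
    (forall x, a < x < b -> df' x <= dh x) -> f' b - f' a <= h b - h a.
  move=> f' df' cf' Df' f'h.
  have D x : x \in `]a, b[ -> is_derive x 1 (h \- f') ((dh \- df') x).
    by rewrite in_itv/= => xab; apply: is_deriveB; [exact: Dh|exact: Df'].
  have C : {within `[a, b], continuous (h \- f')}.
    by move=> x; apply: continuousB; [exact: ch|exact: cf'].
  have [c] := MVT ab D C; rewrite in_itv/= => cab /= E.
  have : 0 <= (dh c - df' c) * (b - a).
    by rewrite mulr_ge0 ?subr_ge0 ?f'h// ltW.
  by rewrite -E; lra.
rewrite ler_norml; apply/andP; split; last first.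
  by apply: (H f df) => // x xab; exact: le_trans (ler_norm _) (fh _ xab).
have := H (\- f) (\- df); rewrite /= opprK => K.
suff: - f b + f a <= h b - h a by lra.
apply: K => //.
- by move=> x; apply: continuousN; exact: cf.
- by move=> x xab; apply: is_deriveN; exact: Df.
- by move=> x xab; rewrite (le_trans _ (fh _ xab))// -normrN ler_norm.
Qed.

Lemma is_derive_cM c f x df : is_derive x 1 f df ->
  is_derive x 1 (fun t => c * f t) (c * df).
Proof. exact: is_deriveZ. Qed.

Lemma is_derive_inv x : 0 < x -> is_derive x 1 (fun t : R => t^-1) (- x ^- 2).
Proof.
move=> x0; rewrite -[X in is_derive _ _ _ X]mulr1.
by apply: is_deriveV; rewrite gt_eqF.
Qed.

End Rint_theory.

(** * The relativistic density and pressure *)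

Section relativistic_estimates.
Context {R : realType}.
Local Notation mu := (@lebesgue_measure R).
Local Notation Rint := Defs.Rint.
Implicit Types (a b c e p q r t x y eta : R).

Lemma measurable_sqrtr : measurable_fun [set: R] (@Num.sqrt R).
Proof. by apply: nondecreasing_measurable => // x y; exact: ler_wsqrtr. Qed.

(** Follows from sqrt (u + e^2) <= sqrt u + e. The radicand [q] may be negative, as happens to the
    relativistic one near the end of its support. *)
Lemma sqrtr_dist p q e : 0 <= e -> 0 <= p -> `|q - p| <= e ^+ 2 ->
  `|Num.sqrt q - Num.sqrt p| <= e.
Proof.
move=> e0 p0 pq.
have H u v : 0 <= u -> v <= u + e ^+ 2 -> Num.sqrt v <= Num.sqrt u + e.
  move=> u0 vu; rewrite -[leRHS]ger0_norm ?addr_ge0 ?sqrtr_ge0// -sqrtr_sqr.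
  apply: ler_wsqrtr; rewrite (le_trans vu)// sqrrD sqr_sqrtr// lerD2r lerDl.
  by rewrite mulrn_wge0// mulr_ge0// sqrtr_ge0.
move: pq; rewrite ler_norml => /andP[pq1 pq2].
have qp : Num.sqrt q <= Num.sqrt p + e by apply: H => //; lra.
have pq : Num.sqrt p <= Num.sqrt q + e.
  (* For negative [q] the root is 0 by convention, and p <= q + e^2 <= e^2. *)
  have [q0|/ltW q0] := leP 0 q; first by apply: H => //; lra.
  rewrite (ler0_sqrtr q0) add0r -(ger0_norm e0) -sqrtr_sqr.
  by apply: ler_wsqrtr; lra.
by rewrite ler_norml; apply/andP; split; lra.
Qed.

Lemma gt0_powRD x r t : 0 < x -> x `^ (r + t) = x `^ r * x `^ t.
Proof. by move=> x0; rewrite powRD// (gt_eqF x0) implybT. Qed.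

(** From exp(-t) >= 1 - t one gets exp t <= 1 / (1 - t), and (1 - t)(1 + t + 2 t^2) = 1 + t^2 (1 - 2
    t) >= 1. *)
Lemma expR_le_quadratic t : 0 <= t -> t <= 1 / 2 ->
  expR t <= 1 + t + 2 * t ^+ 2.
Proof.
move=> t0 t2; have t1 : 0 < 1 - t by lra.
have : 1 - t <= expR (- t) by rewrite expR_ge1Dx.
rewrite expRN => H; have e0 := expR_gt0 t.
have : expR t * (1 - t) <= 1.
  by rewrite -[leRHS](mulfV (lt0r_neq0 e0)) ler_pM2l.
nra.
Qed.

Lemma Rint_extend c b f : c <= b -> mu.-integrable `]0, b] (EFin \o f) ->
  (forall x, c < x -> x <= b -> f x = 0) -> Rint 0 c f = Rintegral mu `]0, b] f.
Proof. by move=> cb intf f0; rewrite Rintegral_itv_obnd_cbnd// (@Rint_eq_tail _ c b). Qed.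

Definition rel_root y eta := Num.sqrt (expR (2 * y) * (1 - eta) ^+ 2 - 1).

Lemma rel_root_ge0 y eta : 0 <= rel_root y eta.
Proof. exact: sqrtr_ge0. Qed.

Lemma measurable_rel_root y (D : set R) : measurable_fun D (rel_root y).
Proof.
apply: measurable_funTS; apply: measurableT_comp; first exact: measurable_sqrtr.
apply: measurable_funB => //; apply: measurable_funM => //.
by apply: measurable_funX; apply: measurable_funB.
Qed.

(** At eta = 1 - exp(-y) the product exp(y) (1 - eta) equals 1. The bound [eta <= 1] excludes the
    range where the square grows again. *)
Lemma rel_root_eq0 y eta : eta <= 1 -> 1 - expR (- y) <= eta -> rel_root y eta = 0.
Proof.
move=> eta1 yeta; apply: ler0_sqrtr.
have -> : expR (2 * y) = expR y ^+ 2 by rewrite expRM_natl.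
have : expR y * (1 - eta) <= 1.
  have e0 := expR_gt0 y; rewrite -[leRHS](mulfV (lt0r_neq0 e0)) ler_pM2l// -expRN.
  lra.
have : 0 <= expR y * (1 - eta) by rewrite mulr_ge0 ?expR_ge0//; lra.
by rewrite -exprMn; nra.
Qed.

Lemma rel_root_le y eta : 0 <= eta -> eta <= 1 -> rel_root y eta <= expR y.
Proof.
move=> eta0 eta1; rewrite -[leRHS]ger0_norm ?expR_ge0// -sqrtr_sqr.
apply: ler_wsqrtr; have -> : expR (2 * y) = expR y ^+ 2 by rewrite expRM_natl.
have := exprn_ge0 2 (expR_ge0 y); set E := expR y ^+ 2 => E0.
have : E * (1 - eta) ^+ 2 <= E * 1 by rewrite ler_wpM2l//; nra.
lra.
Qed.

Lemma rel_root_homo y1 y2 eta : y1 <= y2 -> rel_root y1 eta <= rel_root y2 eta.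
Proof.
move=> y12; apply: ler_wsqrtr; rewrite lerD2r ler_wpM2r ?sqr_ge0//.
by rewrite ler_expR ler_pM2l.
Qed.

(** The two radicands differ by terms quadratic in [y], in total at most 16 y^2 = (4 y)^2, so
    [sqrtr_dist] applies with [e] equal to 4 y. *)
Lemma rel_root_dist y eta : 0 <= eta -> eta <= y -> y <= 1 / 8 ->
  `|rel_root y eta - Num.sqrt (2 * (y - eta))| <= 4 * y.
Proof.
move=> eta0 etay y8; apply: sqrtr_dist; [lra|lra|].
have H1 : 1 + 2 * y <= expR (2 * y) by rewrite expR_ge1Dx.
have H2 : expR (2 * y) <= 1 + 2 * y + 2 * (2 * y) ^+ 2.
  by apply: expR_le_quadratic; lra.
set E := expR (2 * y) in H1 H2 *.
have -> : E * (1 - eta) ^+ 2 - 1 - 2 * (y - eta) =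
  (eta ^+ 2 - 4 * (y * eta) + 2 * (y * eta ^+ 2)) + (E - 1 - 2 * y) * (1 - eta) ^+ 2.
  by ring.
have T1 : 0 <= (E - 1 - 2 * y) * (1 - eta) ^+ 2.
  by rewrite mulr_ge0 ?sqr_ge0//; lra.
have T2 : (E - 1 - 2 * y) * (1 - eta) ^+ 2 <= (E - 1 - 2 * y) * 1.
  by rewrite ler_wpM2l; [|lra|nra].
have e2 : eta ^+ 2 <= y ^+ 2 by nra.
have e20 : 0 <= eta ^+ 2 by nra.
have ye : y * eta <= y ^+ 2 by nra.
have ye0 : 0 <= y * eta by nra.
have ye2 : y * eta ^+ 2 <= y ^+ 2 by nra.
have ye20 : 0 <= y * eta ^+ 2 by nra.
by rewrite ler_norml; apply/andP; split; nra.
Qed.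

Lemma rel_root_le_sqrt y eta : 0 <= eta -> eta <= y -> y <= 1 / 8 ->
  rel_root y eta <= 6 * Num.sqrt y.
Proof.
move=> eta0 etay y8; have := rel_root_dist _ _ eta0 etay y8.
rewrite ler_norml => /andP[_ H].
have y0 : 0 <= y by lra.
have s0 := sqrtr_ge0 y; have sE := sqr_sqrtr y0.
have : Num.sqrt (2 * (y - eta)) <= 2 * Num.sqrt y.
  rewrite -[leRHS]ger0_norm ?mulr_ge0// -sqrtr_sqr; apply: ler_wsqrtr.
  by rewrite exprMn sE; lra.
have : y <= Num.sqrt y by nra.
lra.
Qed.

(** The smooth factor of the integrand of [rel_g], which tends to 1 in the Newtonian limit. *)
Definition rel_weight y eta := expR (3 * y) * (1 - eta) ^+ 2.

Lemma rel_weight_dist y eta : 0 <= eta -> eta <= y -> y <= 1 / 8 ->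
  `|rel_weight y eta - 1| <= 6 * y.
Proof.
move=> eta0 etay y8; rewrite /rel_weight.
have H1 : 1 + 3 * y <= expR (3 * y) by rewrite expR_ge1Dx.
have H2 : expR (3 * y) <= 1 + 3 * y + 2 * (3 * y) ^+ 2.
  by apply: expR_le_quadratic; lra.
set E := expR (3 * y) in H1 H2 *.
have E6 : E <= 1 + 6 * y by nra.
have T1 : E * (1 - eta) ^+ 2 <= E * 1.
  by rewrite ler_wpM2l; [|lra|nra].
have T2 : 1 * (1 - eta) ^+ 2 <= E * (1 - eta) ^+ 2.
  by rewrite ler_wpM2r ?sqr_ge0//; lra.
by rewrite ler_norml; apply/andP; split; nra.
Qed.

Section bounded_profile.
Variables (Phi : R -> R) (b B : R).
Hypotheses (mPhi : measurable_fun setT Phi) (Phi_ge0 : forall eta, 0 <= Phi eta).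
Hypothesis b1 : b <= 1.
Hypothesis PhiB : forall eta, 0 < eta -> eta <= b -> Phi eta <= B.

Let g_integrand y eta := Phi eta * (1 - eta) ^+ 2 * rel_root y eta.
Let P_integrand y eta := Phi eta * rel_root y eta ^+ 3.

(** The interval is open at 0 because the asymptotic assumption says nothing about [Phi 0]. *)
Lemma integrable_rel_g y : mu.-integrable `]0, b] (EFin \o g_integrand y).
Proof.
apply: (@integrable_itv _ _ _ _ _ _ (B * 1 * expR y)).
  apply: measurable_funM; last exact: measurable_rel_root.
  apply: measurable_funM; first exact: measurable_funTS.
  by apply: measurable_funX; apply: measurable_funB.
move=> x /=; rewrite in_itv/= => /andP[x0 xb].
have w0 : 0 <= (1 - x) ^+ 2 by rewrite sqr_ge0.
have x1 := le_trans xb b1.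
rewrite ger0_norm /g_integrand; last first.
  exact: (mulr_ge0 (mulr_ge0 (Phi_ge0 _) (sqr_ge0 _)) (rel_root_ge0 _ _)).
apply: ler_pM => //; [by rewrite mulr_ge0|exact: rel_root_ge0| |].
  by apply: ler_pM => //; [exact: PhiB|nra].
by apply: rel_root_le; lra.
Qed.

Lemma integrable_rel_P y : mu.-integrable `]0, b] (EFin \o P_integrand y).
Proof.
apply: (@integrable_itv _ _ _ _ _ _ (B * expR y ^+ 3)).
  apply: measurable_funM; first exact: measurable_funTS.
  by apply: measurable_funX; exact: measurable_rel_root.
move=> x /=; rewrite in_itv/= => /andP[x0 xb].
have x1 := le_trans xb b1; have r0 := rel_root_ge0 y x.
rewrite ger0_norm /P_integrand; last by rewrite mulr_ge0// exprn_ge0.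
apply: ler_pM => //; [by rewrite exprn_ge0|exact: PhiB|].
by rewrite lerXn2r ?nnegrE ?expR_ge0//; apply: rel_root_le; lra.
Qed.

Let expRN_itv y : 0 < y -> y <= b ->
  0 <= 1 - expR (- y) /\ 1 - expR (- y) <= b.
Proof.
move=> y0 yb; have := expR_ge1Dx (- y); have : expR (- y) <= 1.
  by rewrite -expR0 ler_expR; lra.
by split; lra.
Qed.

(* The square root vanishes for [1 - exp(-y) <= eta <= 1], so that the domain of
   integration can be made independent of [y]; the junk value of [Num.sqrt] at
   negative numbers also covers [y <= 0]. *)
Lemma rel_gE y : y <= b ->
  rel_g Phi y = 4 * pi * expR (3 * y) * Rintegral mu `]0, b] (g_integrand y).
Proof.
move=> yb; rewrite /rel_g; case: ltP => [y0|y0].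
  have [? ?] := expRN_itv _ y0 yb.
  rewrite -(@Rint_extend (1 - expR (- y)))//; first exact: integrable_rel_g.
  move=> x x1 x2; have x3 := le_trans x2 b1.
  by rewrite /g_integrand rel_root_eq0 ?mulr0//; lra.
rewrite (@eq_Rintegral _ _ _ mu _ (cst 0)) ?Rintegral_cst ?mul0r ?mulr0//.
move=> x; rewrite inE/= in_itv/= => /andP[x0 xb].
rewrite /g_integrand rel_root_eq0 ?mulr0//; first exact: le_trans b1.
have : expR 0 <= expR (- y) by rewrite ler_expR; lra.
by rewrite expR0; lra.
Qed.

Lemma rel_PE y : 0 < y -> y <= b ->
  rel_P Phi y = 4 * pi / 3 * expR y * Rintegral mu `]0, b] (P_integrand y).
Proof.
move=> y0 yb; rewrite /rel_P y0; have [? ?] := expRN_itv _ y0 yb.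
rewrite -(@Rint_extend (1 - expR (- y)))//; first exact: integrable_rel_P.
move=> x x1 x2; have x3 := le_trans x2 b1.
by rewrite /P_integrand rel_root_eq0 ?expr0n ?mulr0//; lra.
Qed.

(** Over the fixed domain of [rel_gE], the exponential prefactor and the integrand both increase
    with [y]. *)
Lemma rel_g_homo y1 y2 : y1 <= y2 -> y2 <= b -> rel_g Phi y1 <= rel_g Phi y2.
Proof.
move=> y12 y2b; rewrite (rel_gE _ (le_trans y12 y2b)) (rel_gE _ y2b).
have p0 := pi_ge0 R; apply: ler_pM.
- by rewrite !mulr_ge0// expR_ge0.
- apply: Rintegral_ge0 => x _.
  exact: (mulr_ge0 (mulr_ge0 (Phi_ge0 _) (sqr_ge0 _)) (rel_root_ge0 _ _)).
- by rewrite ler_wpM2l ?mulr_ge0// ler_expR ler_pM2l.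
apply: le_Rintegral => //; [exact: integrable_rel_g..|].
move=> x _; apply: (ler_wpM2l (mulr_ge0 (Phi_ge0 _) (sqr_ge0 _))).
exact: rel_root_homo.
Qed.

End bounded_profile.

Lemma rel_g_ge0 (Phi : R -> R) y : (forall eta, 0 <= Phi eta) -> 0 <= rel_g Phi y.
Proof.
move=> Phi0; rewrite /rel_g; case: ifP => // _; have p0 := pi_ge0 R.
rewrite mulr_ge0 ?mulr_ge0 ?expR_ge0//.
apply: Rintegral_ge0 => x _.
exact: (mulr_ge0 (mulr_ge0 (Phi0 _) (sqr_ge0 _)) (sqrtr_ge0 _)).
Qed.

Lemma rel_P_ge0 (Phi : R -> R) y : (forall eta, 0 <= Phi eta) -> 0 <= rel_P Phi y.
Proof.
move=> Phi0; rewrite /rel_P; case: ifP => // _; have p0 := pi_ge0 R.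
rewrite mulr_ge0 ?mulr_ge0 ?expR_ge0//.
by apply: Rintegral_ge0 => x _; rewrite mulr_ge0// exprn_ge0// sqrtr_ge0.
Qed.

End relativistic_estimates.

(** * The Newtonian density *)

Section newtonian_density.
Context {R : realType}.
Local Notation mu := (@lebesgue_measure R).
Local Notation Rint := Defs.Rint.
Variables (C k : R).
Hypotheses (C_gt0 : 0 < C) (k_gt0 : 0 < k).

Let n := k + 3 / 2.

Let Phi0E x : 0 < x -> Phi0 C k x = C * x `^ k.
Proof. by move=> x0; rewrite /Phi0 x0. Qed.

Lemma Phi0_ge0 x : 0 <= Phi0 C k x.
Proof. by rewrite /Phi0; case: ifP => // x0; rewrite mulr_ge0 ?powR_ge0// ltW. Qed.

Lemma Phi0_homo x y : x <= y -> Phi0 C k x <= Phi0 C k y.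
Proof.
move=> xy; rewrite [leLHS]/Phi0; case: ltP => x0; last exact: Phi0_ge0.
rewrite Phi0E ?(lt_le_trans x0)// ler_pM2l//.
have y0 := lt_le_trans x0 xy.
by apply: ge0_ler_powR; rewrite ?nnegrE ?(ltW x0) ?(ltW y0) ?(ltW k_gt0).
Qed.

Lemma measurable_Phi0 (D : set R) : measurable_fun D (Phi0 C k).
Proof.
by apply: measurable_funTS; apply: nondecreasing_measurable => // x y; exact: Phi0_homo.
Qed.

Lemma integrable_newt_g (b0 : bool) b x :
  mu.-integrable [set` Interval (BSide b0 0) (BRight b)]
    (EFin \o (fun eta => Phi0 C k eta * Num.sqrt (x - eta))).
Proof.
apply: (@integrable_itv _ _ _ _ _ _ (Phi0 C k b * Num.sqrt x)).
  apply: measurable_funM; first exact: measurable_Phi0.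
  apply: measurable_funTS; apply: measurableT_comp; first exact: measurable_sqrtr.
  exact: measurable_funB.
move=> t /=; rewrite in_itv/= => /andP[t0 tb].
have {}t0 : 0 <= t by move: t0; case: (b0) => //= /ltW.
rewrite ger0_norm ?mulr_ge0 ?Phi0_ge0 ?sqrtr_ge0//.
apply: ler_pM => //; [exact: Phi0_ge0|exact: Phi0_homo|].
by apply: ler_wsqrtr; lra.
Qed.

(** The constant gamma of the overview, 4 pi sqrt 2 C times the Beta value B(k + 1, 3/2), kept in
    integral form. *)
Definition newt_coef := newt_g C k 1.

Lemma newt_coef_gt0 : 0 < newt_coef.
Proof.
rewrite /newt_coef /newt_g ltr01 mulr_gt0//.
  by rewrite mulr_gt0 ?sqrtr_gt0// mulr_gt0// pi_gt0.
(* A lower bound of the integrand on [1/4, 1/2]: the first factor is smallest at the left end, the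
   root at the right end. *)
pose c := Phi0 C k (1 / 4) * Num.sqrt (1 / 2).
have c0 : 0 < c.
  rewrite /c Phi0E; last lra.
  by rewrite mulr_gt0 ?sqrtr_gt0 ?mulr_gt0 ?powR_gt0//; lra.
apply: (@lt_le_trans _ _ (c * (1 / 2 - 1 / 4))); first by rewrite mulr_gt0//; lra.
apply: Rint_ge; [lra|lra|lra|exact: integrable_newt_g| |].
  by move=> x _; rewrite mulr_ge0 ?Phi0_ge0 ?sqrtr_ge0.
move=> x /andP[x4 x2]; apply: ler_pM; rewrite ?Phi0_ge0 ?sqrtr_ge0//.
  exact: Phi0_homo.
by apply: ler_wsqrtr; lra.
Qed.

(** Substituting eta = x t extracts x^k from [Phi0], x^(1/2) from the root and x from the
    differential. *)
Lemma newt_gE x : 0 < x -> newt_g C k x = newt_coef * x `^ n.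
Proof.
move=> x0; rewrite /newt_coef /newt_g x0 ltr01 -!mulrA; congr (_ * (_ * _)).
rewrite [in LHS](_ : x = x * 1); last by rewrite mulr1.
rewrite Rint_scale//; last 2 first.
- have /integrableP[/measurable_EFinP] := integrable_newt_g true (x * 1) (x * 1).
  by [].
- by move=> t _; rewrite mulr_ge0 ?Phi0_ge0 ?sqrtr_ge0.
rewrite /Rint (@eq_Rintegral _ _ _ mu _ 
  (fun t => (x `^ k * Num.sqrt x) * (Phi0 C k t * Num.sqrt (1 - t)))); last first.
  move=> t; rewrite inE/= in_itv/= => /andP[t0 t1].
  rewrite -mulrBr sqrtrM ?(ltW x0)// /Phi0 pmulr_rgt0//.
  by case: ifP => _; rewrite ?mul0r ?mulr0// powRM ?(ltW x0)//; ring.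
rewrite RintegralZl//; last exact: (integrable_newt_g true 1 1).
set I := Rintegral _ _ _.
have -> : x `^ n = x * (x `^ k * Num.sqrt x).
  rewrite -powR12_sqrt ?(ltW x0)// -gt0_powRD//.
  rewrite -[X in X * _](@powRr1 _ x) ?(ltW x0)// -gt0_powRD//.
  by rewrite /n; congr (_ `^ _); lra.
by ring.
Qed.

Lemma newt_g_ge0 x : 0 <= newt_g C k x.
Proof.
have [x0|x0] := ltP 0 x; last by rewrite /newt_g ltNge x0.
by rewrite newt_gE// mulr_ge0 ?powR_ge0// ltW// newt_coef_gt0.
Qed.

Lemma newt_g_npos x : x <= 0 -> newt_g C k x = 0.
Proof. by move=> x0; rewrite /newt_g ltNge x0. Qed.

Lemma newt_g_homo x y : x <= y -> newt_g C k x <= newt_g C k y.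
Proof.
move=> xy; have [x0|x0] := ltP 0 x; last by rewrite newt_g_npos// newt_g_ge0.
have y0 := lt_le_trans x0 xy.
rewrite !newt_gE// ler_pM2l ?newt_coef_gt0//.
have k0 := k_gt0.
by apply: ge0_ler_powR; rewrite ?nnegrE ?(ltW x0) ?(ltW y0)// /n; lra.
Qed.

(** As n >= 1, the derivative n t^(n-1) of the power is at most n on ]0, 1]. If x <= 0 < y, then y^n
    <= y <= y - x. *)
Lemma newt_g_lipschitz x y : x <= 1 -> y <= 1 ->
  `|newt_g C k x - newt_g C k y| <= newt_coef * n * `|x - y|.
Proof.
have g0 := newt_coef_gt0; have n1 : 1 <= n by have k0 := k_gt0; rewrite /n; lra.
have powc (u v : R) : 0 < u -> u <= v -> v <= 1 -> v `^ n - u `^ n <= n * (v - u).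
  rewrite le_eqVlt => u0 /predU1P[-> _|uv v1]; first by rewrite !subrr mulr0.
  have D t : t \in `]u, v[ -> is_derive t 1 (@powR R ^~ n) (n * t `^ (n - 1)).
    by rewrite in_itv/= => /andP[ut tv]; apply: is_derive1_powR; lra.
  have C' : {within `[u, v], continuous (@powR R ^~ n)}.
    apply: derivable_within_continuous => t; rewrite in_itv/= => /andP[ut _].
    by apply: ex_derive; apply: is_derive1_powR; lra.
  have [t] := MVT uv D C'; rewrite in_itv/= => /andP[ut tv] ->.
  rewrite ler_wpM2r//; first by rewrite subr_ge0 ltW.
  rewrite ler_piMr//; first lra.
  by rewrite -[leRHS](powRr0 t); apply: ger_powR; lra.
wlog xy : x y / x <= y.
  move=> H x1 y1; have [xy|/ltW yx] := leP x y; first exact: H.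
  by rewrite distrC [in leRHS]distrC; exact: H.
move=> x1 y1; rewrite distrC [in leRHS]distrC !ger0_norm ?subr_ge0 ?newt_g_homo//.
have [x0|x0] := ltP 0 x.
  have y0 := lt_le_trans x0 xy.
  by rewrite !newt_gE// -mulrBr -mulrA ler_pM2l//; exact: powc.
rewrite (newt_g_npos x)// subr0.
have [y0|y0] := ltP 0 y; last first.
  by rewrite newt_g_npos// !mulr_ge0 ?subr_ge0 ?(ltW g0)//; lra.
rewrite newt_gE// -mulrA ler_pM2l//.
have : y `^ n <= y by apply: ge1r_powR => //; rewrite y0.
move=> /le_trans; apply; apply: (@le_trans _ _ (y - x)); first lra.
by rewrite ler_peMl// subr_ge0.
Qed.

End newtonian_density.

(** * Relativistic against Newtonian density at small arguments *)

Section density_comparison.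
Context {R : realType}.
Local Notation mu := (@lebesgue_measure R).
Variables (Phi : R -> R) (C k delta M b : R).
Hypotheses (mPhi : measurable_fun setT Phi) (Phi_ge0 : forall eta, 0 <= Phi eta).
Hypotheses (C_gt0 : 0 < C) (k_gt0 : 0 < k) (delta_gt0 : 0 < delta) (M_ge0 : 0 <= M).
Hypothesis b_le : b <= 1 / 8.
Hypothesis Phi_asympt : forall eta, 0 < eta -> eta <= b ->
  `|Phi eta - C * eta `^ k| <= M * eta `^ (k + delta).

Let d1 := Num.min delta (1 / 2).

Lemma Phi_le eta y : 0 < eta -> eta <= y -> y <= b -> Phi eta <= (C + M) * y `^ k.
Proof.
move=> eta0 etay yb; have y0 := lt_le_trans eta0 etay.
have y1 : y <= 1 by apply: (le_trans yb); apply: (le_trans b_le); lra.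
have := Phi_asympt _ eta0 (le_trans etay yb); rewrite ler_norml => /andP[_ H].
have E1 : eta `^ k <= y `^ k.
  by apply: ge0_ler_powR; rewrite ?nnegrE ?(ltW k_gt0) ?(ltW eta0) ?(ltW y0).
have E2 : eta `^ (k + delta) <= eta `^ k.
  by apply: ger_powR; [rewrite eta0 (le_trans etay)|rewrite lerDl ltW].
have := ler_wpM2l M_ge0 (le_trans E2 E1); have := ler_wpM2l (ltW C_gt0) E1.
rewrite mulrDl; lra.
Qed.

Let B := (C + M) * b `^ k.

Lemma Phi_le_bound eta : 0 < eta -> eta <= b -> Phi eta <= B.
Proof. by move=> eta0 etab; exact: Phi_le. Qed.

Let b_le1 : b <= 1. Proof. by apply: (le_trans b_le); lra. Qed.

Lemma rel_g_nondecreasing y1 y2 : y1 <= y2 -> y2 <= b ->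
  rel_g Phi y1 <= rel_g Phi y2.
Proof. exact: (rel_g_homo _ _ _ mPhi Phi_ge0 b_le1 Phi_le_bound). Qed.

(** 12 = 2 * 6 bounds weight times root next to the error of [Phi]; 40 = 36 + 4 adds the errors of
    the weight and of the root. *)
Let K := 12 * M + 40 * C.

Lemma rel_g_integrand_dist eta y : 0 < eta -> eta <= y -> y <= b ->
  `|Phi eta * (rel_weight y eta * rel_root y eta) -
    Phi0 C k eta * Num.sqrt (2 * (y - eta))|
  <= K * (y `^ k * y `^ d1 * Num.sqrt y).
Proof.
move=> eta0 etay yb; have y0 := lt_le_trans eta0 etay.
have y8 : y <= 1 / 8 := le_trans yb b_le.
have y1 : y <= 1 by lra.
have w1 := rel_weight_dist _ _ (ltW eta0) etay y8.
have q1 := rel_root_dist _ _ (ltW eta0) etay y8.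
have q6 := rel_root_le_sqrt _ _ (ltW eta0) etay y8.
have q0 := rel_root_ge0 y eta.
have f1 := Phi_asympt _ eta0 (le_trans etay yb).
rewrite /Phi0 eta0.
set q := rel_root y eta in q0 q1 q6 *; set W := rel_weight y eta in w1 *.
set p := Num.sqrt (2 * (y - eta)) in q1 *; set f := Phi eta in f1 *.
set r := Num.sqrt y in q6 *; set A := y `^ k; set D := y `^ d1.
have r0 : 0 <= r by exact: sqrtr_ge0.
have rE : r * r = y by rewrite -expr2 sqr_sqrtr// ltW.
have A0 : 0 <= A by exact: powR_ge0.
have rD : r <= D.
  rewrite /r -powR12_sqrt ?(ltW y0)// /D; apply: ger_powR; first by rewrite y0.
  by rewrite /d1 ge_min; apply/orP; right; lra.
have phi1 : eta `^ k <= A.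
  by apply: ge0_ler_powR; rewrite ?nnegrE ?(ltW k_gt0) ?(ltW eta0) ?(ltW y0).
have phi2 : eta `^ (k + delta) <= A * D.
  rewrite gt0_powRD//; apply: ler_pM => //; try exact: powR_ge0.
  apply: (@le_trans _ _ (y `^ delta)).
    by apply: ge0_ler_powR; rewrite ?nnegrE ?(ltW delta_gt0) ?(ltW eta0) ?(ltW y0).
  by apply: ger_powR; rewrite ?y0// /d1 ge_min lexx.
have phi0 : 0 <= eta `^ k by exact: powR_ge0.
set phi := eta `^ k in f1 phi1 phi0 *.
(* The profile, the weight and the root are replaced by their Newtonian counterparts one at a
   time. *)
have -> : f * (W * q) - C * phi * p =
    (f - C * phi) * (W * q) + C * phi * ((W - 1) * q) + C * phi * (q - p) by ring.
have W0 : 0 <= W by rewrite mulr_ge0 ?expR_ge0 ?sqr_ge0.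
have W2 : W <= 2 by move: w1; rewrite ler_norml => /andP[_]; lra.
have AD0 : 0 <= A * D by rewrite mulr_ge0// powR_ge0.
have M0 := M_ge0; have C0 := ltW C_gt0.
(* The errors linear in [y] are absorbed here: y = r^2, and r <= y^d1 because d1 <= 1/2. *)
have yr : y <= r * D by rewrite -rE ler_wpM2l.
have r1 : r <= 1 by rewrite -(sqrtr1 R) ler_wsqrtr.
have T1 : `|(f - C * phi) * (W * q)| <= M * (A * D) * (2 * (6 * r)).
  rewrite normrM (ger0_norm (mulr_ge0 W0 q0)).
  apply: ler_pM => //; first exact: mulr_ge0.
    by apply: (le_trans f1); rewrite ler_wpM2l.
  exact: ler_pM.
have T2 : `|C * phi * ((W - 1) * q)| <= C * A * (6 * y * (6 * 1)).
  rewrite normrM (ger0_norm (mulr_ge0 C0 phi0)) normrM (ger0_norm q0).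
  apply: ler_pM => //; [exact: mulr_ge0|exact: mulr_ge0|by rewrite ler_wpM2l|].
  by apply: ler_pM => //; lra.
have T3 : `|C * phi * (q - p)| <= C * A * (4 * y).
  rewrite normrM (ger0_norm (mulr_ge0 C0 phi0)).
  by apply: ler_pM => //; [exact: mulr_ge0|rewrite ler_wpM2l].
have T4 : C * A * y <= C * A * (r * D) by rewrite ler_wpM2l// mulr_ge0.
apply: (le_trans (ler_normD _ _)); apply: (le_trans (lerD (ler_normD _ _) (lexx _))).
rewrite /K; lra.
Qed.

Lemma rel_g_newt_dist y : 0 < y -> y <= b ->
  `|rel_g Phi y - newt_g C k y| <= 4 * pi * K * y `^ (k + 3 / 2 + d1).
Proof.
move=> y0 yb; have y1 : y <= 1 := le_trans yb b_le1.
have PhiB eta : 0 < eta -> eta <= y -> Phi eta <= B.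
  by move=> eta0 etay; apply: Phi_le_bound => //; exact: le_trans yb.
have Ig := integrable_rel_g _ _ _ mPhi Phi_ge0 y1 PhiB y.
have In := @integrable_newt_g _ C k C_gt0 k_gt0 false y y.
(* The cut-off is [y] itself, not [b]: both integrals run over ]0, y], whose length supplies the
   missing power of [y]. *)
rewrite (rel_gE _ _ _ mPhi Phi_ge0 y1 PhiB)// /newt_g y0 /Defs.Rint.
rewrite -(Rintegral_itv_obnd_cbnd In) -!(mulrA (4 * pi)).
rewrite -(Rintegral_itvZl _ _ _ _ _ _ Ig)// -(Rintegral_itvZl _ _ _ _ _ _ In)//.
rewrite -mulrBr normrM ger0_norm; last by rewrite mulr_ge0// pi_ge0.
apply: ler_wpM2l; first by rewrite mulr_ge0// pi_ge0.
have -> : K * y `^ (k + 3 / 2 + d1) = K * (y `^ k * y `^ d1 * Num.sqrt y) * (y - 0).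
  rewrite subr0 -powR12_sqrt ?(ltW y0)// -[X in _ = _ * X]powRr1 ?(ltW y0)//.
  rewrite -!mulrA -!gt0_powRD//; congr (_ * (_ `^ _)); lra.
have Zint c f : mu.-integrable `]0, y] (EFin \o f) ->
    mu.-integrable `]0, y] (EFin \o (fun x : R => c * f x)).
  move=> intf; have -> : EFin \o (fun x : R => c * f x) = (fun x => c%:E * (EFin \o f) x)%E.
    by apply/funext => x /=; rewrite EFinM.
  exact: integrableZl.
apply: Rintegral_itv_dist; [exact: ltW|exact: Zint|exact: Zint|].
move=> x /=; rewrite in_itv/= => /andP[x0 xy].
have := rel_g_integrand_dist _ _ x0 xy yb.
by rewrite sqrtrM// /rel_weight; apply: le_trans; rewrite le_eqVlt;
  apply/orP; left; apply/eqP; congr `|_|; ring.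
Qed.

(** The cubed root is at most 216 y^(3/2), the profile O(y^k), the interval has length at most y,
    and exp y <= 2; 144 is 216 * 2 / 3. *)
Lemma rel_P_le y : 0 < y -> y <= b ->
  rel_P Phi y <= 4 * pi * (144 * (C + M)) * y `^ (k + 5 / 2).
Proof.
move=> y0 yb; have y1 : y <= 1 := le_trans yb b_le1.
have y8 : y <= 1 / 8 := le_trans yb b_le.
have PhiB eta : 0 < eta -> eta <= y -> Phi eta <= (C + M) * y `^ k.
  by move=> eta0 etay; exact: Phi_le.
have IP := integrable_rel_P _ _ _ mPhi Phi_ge0 y1 PhiB y.
rewrite (rel_PE _ _ _ mPhi Phi_ge0 y1 PhiB)//.
have r0 := sqrtr_ge0 y; set r := Num.sqrt y in r0 *.
have rE : r * r = y by rewrite -expr2 sqr_sqrtr// ltW.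
have A0 : 0 <= y `^ k by exact: powR_ge0.
have CM0 : 0 <= C + M by rewrite addr_ge0// ltW.
have H : Rintegral mu `]0, y] (fun eta => Phi eta * rel_root y eta ^+ 3) <=
    (C + M) * y `^ k * (6 * r) ^+ 3 * (y - 0).
  apply: Rintegral_itv_le => //; first exact: ltW.
  move=> x /=; rewrite in_itv/= => /andP[x0 xy]; apply: ler_pM => //.
  - by rewrite exprn_ge0// rel_root_ge0.
  - exact: PhiB.
  rewrite lerXn2r ?nnegrE ?rel_root_ge0 ?mulr_ge0//.
  by apply: rel_root_le_sqrt => //; exact: ltW.
have p0 := pi_ge0 R.
have e2 : expR y <= 2.
  by have := expR_le_quadratic y (ltW y0); move=> /(_ _)/le_trans; apply; nra.
have -> : 4 * pi * (144 * (C + M)) * y `^ (k + 5 / 2) =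
    4 * pi / 3 * 2 * ((C + M) * y `^ k * (6 * r) ^+ 3 * (y - 0)).
  have -> : y `^ (k + 5 / 2) = y `^ k * (y * (y * r)).
    rewrite /r -powR12_sqrt ?(ltW y0)// -[X in X * (X * _)]powRr1 ?(ltW y0)//.
    by rewrite -!gt0_powRD//; congr (_ `^ _); lra.
  have -> : (6 * r) ^+ 3 = 216 * ((r * r) * r) by ring.
  by rewrite rE; field.
apply: ler_pM => //.
- by rewrite !mulr_ge0 ?expR_ge0.
- by apply: Rintegral_ge0 => x _; rewrite mulr_ge0// exprn_ge0// rel_root_ge0.
- by rewrite ler_wpM2l// !mulr_ge0.
Qed.

End density_comparison.

(** * Steady states *)

Section steady_states.
Context {R : realType}.
Local Notation mu := (@lebesgue_measure R).
Local Notation Rint := Defs.Rint.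
Implicit Types (a b r s t x B : R).

Lemma half_line_continuous (u du : R -> R) a b :
  u x @[x --> 0^'+] --> u 0 -> (forall s, 0 < s -> is_derive s 1 u (du s)) ->
  0 <= a -> a < b -> {within `[a, b], continuous u}.
Proof.
move=> u0 Du a0 ab; have b0 := le_lt_trans a0 ab.
have cu s : 0 < s -> {for s, continuous u}.
  by move=> s0; apply/differentiable_continuous/derivable1_diffP/ex_derive; exact: Du.
apply/(continuous_within_itvP _ ab); split.
- by move=> s; rewrite in_itv/= => /andP[xa _]; apply: cu; exact: le_lt_trans xa.
- move: a0; rewrite le_eqVlt => /predU1P[<-//|a0].
  by apply: cvg_at_right_filter; exact: cu.
- by apply: cvg_at_left_filter; exact: cu.
Qed.

Lemma half_line_nonincreasing (u du : R -> R) s t :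
  u x @[x --> 0^'+] --> u 0 -> (forall s, 0 < s -> is_derive s 1 u (du s)) ->
  (forall s, 0 < s -> du s <= 0) -> 0 <= s -> s <= t -> u t <= u s.
Proof.
move=> u0 Du du0 s0; rewrite le_eqVlt => /predU1P[->//|st].
have D x : x \in `]s, t[ -> is_derive x 1 u (du x).
  by rewrite in_itv/= => /andP[sx _]; apply: Du; exact: le_lt_trans sx.
have [c] := MVT st D (half_line_continuous _ _ _ _ u0 Du s0 st).
rewrite in_itv/= => /andP[sc _] E; rewrite -subr_le0 E.
by rewrite mulr_le0_ge0 ?subr_ge0 ?(ltW st)// du0// (le_lt_trans s0).
Qed.

(** Measurability comes from monotonicity: a nondecreasing function of a nonincreasing one is
    nonincreasing. *)
Lemma integrable_mass_density (G u : R -> R) B r :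
  (forall x, 0 <= G x) -> (forall x y, x <= y -> y <= B -> G x <= G y) ->
  (forall s t, 0 <= s -> s <= t -> u t <= u s) -> u 0 <= B ->
  mu.-integrable `[0, r] (EFin \o (fun t => t ^+ 2 * G (u t))).
Proof.
move=> G_ge0 G_homo u_ni u0B.
have uB s : 0 <= s -> u s <= B by move=> s0; apply: le_trans u0B; exact: u_ni.
apply: (@integrable_itv _ _ _ _ _ _ (r ^+ 2 * G B)).
  apply: measurable_funM; first exact: measurable_funX.
  (* [u] is monotone on the half line only, so it is extended to the left by its value at 0. *)
  have E : {in `[0, r]%classic, (fun t => G (u (Num.max 0 t))) =1 (fun t => G (u t))}.
    by move=> t; rewrite inE/= in_itv/= => /andP[t0 _]; rewrite (max_idPr t0).
  apply: (eq_measurable_fun _ E); apply: nonincreasing_measurable => // s t st.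
  apply: G_homo; last by apply: uB; rewrite le_max lexx.
  apply: u_ni; first by rewrite le_max lexx.
  by rewrite ge_max !le_max lexx st orbT.
move=> t /=; rewrite in_itv/= => /andP[t0 tr].
rewrite ger0_norm; last by rewrite mulr_ge0 ?sqr_ge0.
apply: ler_pM; rewrite ?sqr_ge0//; last by apply: G_homo => //; exact: uB.
by rewrite lerXn2r ?nnegrE// (le_trans t0).
Qed.

Definition steady_mass (G u : R -> R) (s : R) : R :=
  4 * pi * Rint 0 s (fun t => t ^+ 2 * G (u t)).

Definition steady_slope (kappa : R) (G H u : R -> R) (s : R) : R :=
  - (1 / (1 - kappa * (2 * steady_mass G u s / s))) *
    (steady_mass G u s / s ^+ 2 + 4 * pi * kappa * s * H (u s)).

(* The rescaled problem; the Newtonian one is the case [kappa = 0]. *)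
Definition steady (kappa : R) (G H u : R -> R) : Prop :=
  [/\ u 0 = 1, u x @[x --> 0^'+] --> (1 : R) &
    forall s, 0 < s -> kappa * (2 * steady_mass G u s / s) < 1 /\
      is_derive s 1 u (steady_slope kappa G H u s)].

Section one_solution.
Variables (kappa : R) (G H u : R -> R).
Hypotheses (kappa_ge0 : 0 <= kappa) (G_ge0 : forall x, 0 <= G x).
Hypotheses (G_homo : forall x y, x <= y -> y <= 1 -> G x <= G y).
Hypotheses (G_npos : forall x, x <= 0 -> G x = 0) (H_ge0 : forall x, 0 <= H x).
Hypothesis steady_u : steady kappa G H u.

Lemma steady_mass_ge0 s : 0 <= steady_mass G u s.
Proof.
rewrite /steady_mass !mulr_ge0 ?pi_ge0//; apply: Rintegral_ge0 => x _.
exact: mulr_ge0 (sqr_ge0 _) (G_ge0 _).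
Qed.

Lemma steady_slope_le0 s : 0 < s -> steady_slope kappa G H u s <= 0.
Proof.
move=> s0; have [m1 _] := (let: And3 _ _ h := steady_u in h) s s0.
rewrite /steady_slope mulNr oppr_le0 mulr_ge0//.
  by rewrite divr_ge0// subr_ge0 ltW.
rewrite addr_ge0 ?divr_ge0 ?steady_mass_ge0 ?exprn_ge0 ?(ltW s0)//.
by rewrite !mulr_ge0 ?pi_ge0 ?(ltW s0).
Qed.

Let u_derive s : 0 < s -> is_derive s 1 u (steady_slope kappa G H u s).
Proof. by have [_ _ du] := steady_u; move=> s0; exact: (du _ s0).2. Qed.

Let u_right : u x @[x --> 0^'+] --> u 0.
Proof. by have [-> ? _] := steady_u. Qed.

Lemma steady_continuous a b : 0 <= a -> a < b -> {within `[a, b], continuous u}.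
Proof. exact: half_line_continuous u_right u_derive. Qed.

Lemma steady_nonincreasing s t : 0 <= s -> s <= t -> u t <= u s.
Proof. exact: half_line_nonincreasing u_right u_derive steady_slope_le0. Qed.

Lemma steady_le1 s : 0 <= s -> u s <= 1.
Proof. by move=> s0; have [<- _ _] := steady_u; exact: steady_nonincreasing. Qed.

Let G_le_G1 s : 0 <= s -> G (u s) <= G 1.
Proof. by move=> s0; apply: G_homo => //; exact: steady_le1. Qed.

Lemma integrable_steady_density r :
  mu.-integrable `[0, r] (EFin \o (fun t => t ^+ 2 * G (u t))).
Proof.
exact: (integrable_mass_density _ _ _ _ G_ge0 G_homo steady_nonincreasing (steady_le1 _ (lexx 0))).
Qed.

Lemma steady_mass_le s : 0 <= s -> steady_mass G u s <= 4 * pi * G 1 * s ^+ 3.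
Proof.
move=> s0; rewrite /steady_mass -(mulrA (4 * pi)) ler_wpM2l ?mulr_ge0 ?pi_ge0//.
have -> : G 1 * s ^+ 3 = s ^+ 2 * G 1 * (s - 0) by ring.
apply: Rintegral_itv_le => //; first exact: integrable_steady_density.
move=> t /=; rewrite in_itv/= => /andP[t0 ts].
apply: ler_pM; rewrite ?sqr_ge0 ?G_le_G1//.
by rewrite lerXn2r ?nnegrE.
Qed.

(** Only the shell [s/2, s] is counted, where the density is at least [G (u s)]; 4 pi (s/2)^2 (s/2)
    = pi s^3 / 2. *)
Lemma steady_mass_ge s : 0 <= s -> pi / 2 * s ^+ 3 * G (u s) <= steady_mass G u s.
Proof.
move=> s0; rewrite /steady_mass.
have -> : pi / 2 * s ^+ 3 * G (u s) =
    4 * pi * ((s / 2) ^+ 2 * G (u s) * (s - s / 2)) by field.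
rewrite ler_wpM2l ?mulr_ge0 ?pi_ge0//.
apply: Rint_ge; [lra|lra|lra|exact: integrable_steady_density| |].
  by move=> t _; rewrite mulr_ge0 ?sqr_ge0.
move=> t /andP[t1 t2]; have t0 : 0 <= t by lra.
apply: ler_pM; rewrite ?sqr_ge0//; last first.
  by apply: G_homo; [exact: steady_nonincreasing|exact: steady_le1].
by rewrite lerXn2r ?nnegrE//; lra.
Qed.

Lemma steady_mass_homo s t : s <= t -> steady_mass G u s <= steady_mass G u t.
Proof.
move=> st; rewrite /steady_mass ler_wpM2l ?mulr_ge0 ?pi_ge0//.
apply: Rint_homo => //; first exact: integrable_steady_density.
by move=> x _; rewrite mulr_ge0 ?sqr_ge0.
Qed.

Lemma steady_mass_vacuum S s : 0 <= S -> u S <= 0 -> S <= s ->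
  steady_mass G u s = steady_mass G u S.
Proof.
move=> S0 uS Ss; rewrite /steady_mass; congr (_ * _); apply/esym/Rint_eq_tail => //.
move=> x Sx _; rewrite G_npos ?mulr0// (le_trans _ uS)//.
by apply: steady_nonincreasing => //; exact: ltW.
Qed.

End one_solution.

End steady_states.

(** * Comparison of steady states *)

Section comparison.
Context {R : realType}.
Implicit Types (a b c s t x : R).
(* [gamma] bounds the Newtonian density on [0, 1] and [L] is its Lipschitz constant,
   [Kg * eps] bounds its distance to the perturbed density [G], [KH] bounds the
   pressure, and [S] is the length of the interval for the Gronwall argument. *)
Variables gamma Kg KH L S : R.

Definition density_bound := gamma + Kg.
(** The first term bounds the redshift correction, (16 pi density_bound S^2) times (4 pi
    density_bound S); the second is the pressure term, with redshift factor at most 2. *)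
Definition slope_const :=
  64 * pi ^+ 2 * density_bound ^+ 2 * S ^+ 3 + 8 * pi * S * KH.
Definition source_const := 4 * pi * S * Kg + slope_const.
(** Twice the coefficient 4 pi S L with which a deviation of the solutions feeds back into the
    slope, so that the feedback is at most half of the weighted maximum; the 1 makes the rate
    positive. *)
Definition gronwall_rate := 8 * pi * S * L + 1.
Definition interior_const := 2 * source_const * S * expR (gronwall_rate * S).
(** The first term bounds the difference of the total masses at [S], the second the redshift
    correction times the relativistic mass there. *)
Definition exterior_const :=
  4 * pi * S ^+ 3 * (Kg + L * interior_const)
    + 64 * pi ^+ 2 * density_bound ^+ 2 * S ^+ 5.

Variables (kappa eps : R) (G H u g0 v : R -> R).
Hypotheses (gamma_ge0 : 0 <= gamma) (Kg_ge0 : 0 <= Kg) (KH_ge0 : 0 <= KH).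
Hypotheses (L_ge0 : 0 <= L) (S_gt0 : 0 < S).
Hypotheses (kappa_ge0 : 0 <= kappa) (kappa_le : kappa <= eps) (eps_le1 : eps <= 1).
Hypothesis kappa_small : 16 * pi * density_bound * S ^+ 2 * kappa <= 1.
Hypotheses (G_ge0 : forall x, 0 <= G x) (G_npos : forall x, x <= 0 -> G x = 0).
Hypothesis G_homo : forall x y, x <= y -> y <= 1 -> G x <= G y.
Hypotheses (H_ge0 : forall x, 0 <= H x) (H_npos : forall x, x <= 0 -> H x = 0).
Hypothesis H_le : forall x, x <= 1 -> H x <= KH.
Hypotheses (g0_ge0 : forall x, 0 <= g0 x) (g0_npos : forall x, x <= 0 -> g0 x = 0).
Hypothesis g0_homo : forall x y, x <= y -> y <= 1 -> g0 x <= g0 y.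
Hypothesis g0_le : g0 1 <= gamma.
Hypothesis g0_lip : forall x y, x <= 1 -> y <= 1 -> `|g0 x - g0 y| <= L * `|x - y|.
Hypothesis G_dist : forall x, x <= 1 -> `|G x - g0 x| <= Kg * eps.
Hypotheses (steady_u : steady kappa G H u) (steady_v : steady 0 g0 (cst 0) v).

Let p0 : 0 <= pi :> R. Proof. exact: pi_ge0. Qed.
Let eps_ge0 : 0 <= eps. Proof. exact: le_trans kappa_le. Qed.
Let db0 : 0 <= density_bound. Proof. exact: addr_ge0. Qed.

Let G1_le : G 1 <= density_bound.
Proof.
have := G_dist _ (lexx 1); rewrite ler_norml => /andP[_].
have := ler_piMr Kg_ge0 eps_le1; have g := g0_le.
by rewrite /density_bound; lra.
Qed.

Let mass_le s : 0 <= s -> steady_mass G u s <= 4 * pi * density_bound * s ^+ 3.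
Proof.
move=> s0; apply: (le_trans (steady_mass_le _ _ _ _ kappa_ge0 G_ge0 G_homo H_ge0 steady_u _ s0)).
by rewrite ler_wpM2r ?exprn_ge0// ler_wpM2l// mulr_ge0.
Qed.

Let mass_ge0 s : 0 <= steady_mass G u s.
Proof. exact: steady_mass_ge0. Qed.

Let u_le1 s : 0 <= s -> u s <= 1.
Proof. by apply: (steady_le1 _ _ _ _ kappa_ge0 G_ge0 H_ge0 steady_u). Qed.

Let v_le1 s : 0 <= s -> v s <= 1.
Proof. by apply: (steady_le1 _ _ _ _ (lexx 0) g0_ge0 _ steady_v). Qed.

(** The value [g0 (u s)] is inserted because the Lipschitz bound is available for [g0] and not for
    [G]. *)
Lemma density_dist s : 0 <= s ->
  `|G (u s) - g0 (v s)| <= Kg * eps + L * `|u s - v s|.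
Proof.
move=> s0; rewrite -(subrKA (g0 (u s))); apply: (le_trans (ler_normD _ _)).
by apply: lerD; [apply: G_dist; exact: u_le1|apply: g0_lip; [exact: u_le1|exact: v_le1]].
Qed.

Lemma steady_mass_dist s c : 0 <= s ->
  (forall t, 0 <= t -> t <= s -> `|G (u t) - g0 (v t)| <= c) ->
  `|steady_mass G u s - steady_mass g0 v s| <= 4 * pi * c * s ^+ 3.
Proof.
move=> s0 Gc; rewrite /steady_mass -mulrBr normrM ger0_norm ?mulr_ge0//.
rewrite -(mulrA (4 * pi)) ler_wpM2l ?mulr_ge0//.
have -> : c * s ^+ 3 = s ^+ 2 * c * (s - 0) by ring.
apply: Rintegral_itv_dist => //.
- exact: (integrable_steady_density _ _ _ _ kappa_ge0 G_ge0 G_homo H_ge0 steady_u).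
- by apply: (integrable_steady_density _ _ _ _ (lexx 0) g0_ge0 g0_homo _ steady_v).
move=> t /=; rewrite in_itv/= => /andP[t0 ts].
rewrite -mulrBr normrM ger0_norm ?sqr_ge0//.
by apply: ler_pM; rewrite ?sqr_ge0 ?Gc// lerXn2r ?nnegrE.
Qed.

Let slope_vE s : steady_slope 0 g0 (cst 0) v s = - (steady_mass g0 v s / s ^+ 2).
Proof. by rewrite /steady_slope mul0r subr0 divr1 mulN1r !(mulr0, mul0r) addr0. Qed.

(** At s = S the right-hand side is at most 1/2 by [kappa_small], as [redshift_dist] demands. *)
Let compactness_le s : 0 < s -> s <= S ->
  kappa * (2 * steady_mass G u s / s) <= 8 * pi * density_bound * kappa * s ^+ 2.
Proof.
move=> s0 sS.
have -> : 8 * pi * density_bound * kappa * s ^+ 2 =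
   kappa * (2 * (4 * pi * density_bound * s ^+ 3) / s) by field; rewrite gt_eqF.
apply: ler_wpM2l => //; rewrite ler_pM2r ?invr_gt0//.
by rewrite ler_wpM2l// mass_le// ltW.
Qed.

Let compactness_ge0 s : 0 < s -> 0 <= kappa * (2 * steady_mass G u s / s).
Proof. move=> s0; apply: mulr_ge0 => //; apply: divr_ge0; last exact: ltW.
exact: mulr_ge0. Qed.

(* Applied to the compactness [x = 2 kappa m / s]. *)
Lemma redshift_dist (x y : R) : 0 <= x -> x <= y -> y <= 1 / 2 ->
  0 <= 1 / (1 - x) - 1 <= 2 * y.
Proof.
move=> x0 xy y2; have x1 : 0 < 1 - x by lra.
have -> : 1 / (1 - x) - 1 = x / (1 - x) by field; rewrite gt_eqF.
rewrite divr_ge0 ?(ltW x1)//= ler_pdivrMr//; nra.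
Qed.

(** With the redshift factor written 1 + th, the difference consists of the mass difference over
    s^2, which carries [c], and of two terms proportional to kappa. The bound [c] stays a parameter
    so that an exponentially weighted one can be inserted. *)
Lemma steady_slope_dist s c : 0 < s -> s <= S ->
  (forall t, 0 <= t -> t <= s -> `|G (u t) - g0 (v t)| <= c) ->
  `|steady_slope kappa G H u s - steady_slope 0 g0 (cst 0) v s|
    <= 4 * pi * S * c + slope_const * eps.
Proof.
move=> s0 sS Gc; rewrite slope_vE /steady_slope.
have s0' := ltW s0; have S0 := ltW S_gt0; have k0 := kappa_ge0; have e0 := eps_ge0.
have S2 : s ^+ 2 <= S ^+ 2 by rewrite lerXn2r ?nnegrE.
have S3 : s ^+ 3 <= S ^+ 3 by rewrite lerXn2r ?nnegrE.
have dbk0 : 0 <= 8 * pi * density_bound * kappa by rewrite !mulr_ge0.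
have /(_ _)/andP[|th0 th1] := redshift_dist _ _ (compactness_ge0 _ s0) (compactness_le _ s0 sS).
  have := ler_wpM2l dbk0 S2; have := kappa_small; lra.
set th := 1 / _ - 1 in th0 th1.
rewrite (_ : 1 / _ = 1 + th); last by rewrite /th; ring.
have th2 : th <= 1.
  by apply: (le_trans th1); have := ler_wpM2l dbk0 S2; have := kappa_small; lra.
have m0 := mass_ge0 s; have ml := mass_le _ s0'.
have md := steady_mass_dist _ _ s0' Gc.
set m := steady_mass G u s in m0 ml md *; set m' := steady_mass g0 v s in md *.
have h0 := H_ge0 (u s); have hl := H_le _ (u_le1 _ s0').
have s2 : 0 < s ^+ 2 by rewrite exprn_gt0.
have c0 : 0 <= c by apply: le_trans (Gc 0 _ _).
have T1 : `|(m - m') / s ^+ 2| <= 4 * pi * S * c.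
  rewrite normrM [X in _ * X]ger0_norm ?invr_ge0 ?(ltW s2)// ler_pdivrMr//.
  apply: (le_trans md).
  have -> : 4 * pi * c * s ^+ 3 = 4 * pi * s * c * s ^+ 2 by ring.
  by rewrite ler_pM2r// ler_wpM2r// ler_wpM2l// mulr_ge0.
have m2 : m / s ^+ 2 <= 4 * pi * density_bound * s.
  by rewrite ler_pdivrMr//; apply: (le_trans ml); rewrite le_eqVlt; apply/orP; left; apply/eqP; ring.
have m20 : 0 <= m / s ^+ 2 by rewrite divr_ge0// ltW.
have T2 : th * (m / s ^+ 2) <= 64 * pi ^+ 2 * density_bound ^+ 2 * S ^+ 3 * eps.
  apply: (@le_trans _ _ ((2 * (8 * pi * density_bound * kappa * s ^+ 2)) * (4 * pi * density_bound * s))).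
    exact: ler_pM.
  have -> : (2 * (8 * pi * density_bound * kappa * s ^+ 2)) * (4 * pi * density_bound * s)
    = 64 * pi ^+ 2 * density_bound ^+ 2 * (s ^+ 3 * kappa) by ring.
  rewrite -[leRHS]mulrA ler_wpM2l ?mulr_ge0 ?exprn_ge0//.
  by apply: ler_pM => //; exact: exprn_ge0.
have T3 : (1 + th) * (4 * pi * kappa * s * H (u s)) <= 8 * pi * S * KH * eps.
  have -> : 8 * pi * S * KH * eps = 2 * (4 * pi * eps * S * KH) by ring.
  apply: ler_pM; [lra|by rewrite !mulr_ge0|lra|].
  apply: ler_pM => //; first by rewrite !mulr_ge0.
  apply: ler_pM => //; first by rewrite !mulr_ge0.
  by apply: ler_pM => //; rewrite mulr_ge0.
have T30 : 0 <= (1 + th) * (4 * pi * kappa * s * H (u s)).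
  by rewrite mulr_ge0 ?mulr_ge0//; lra.
have T20 : 0 <= th * (m / s ^+ 2) by exact: mulr_ge0.
have -> : - (1 + th) * (m / s ^+ 2 + 4 * pi * kappa * s * H (u s)) - - (m' / s ^+ 2)
  = - ((m - m') / s ^+ 2) - (th * (m / s ^+ 2)
     + (1 + th) * (4 * pi * kappa * s * H (u s))) by ring.
apply: (le_trans (ler_normB _ _)); rewrite normrN [X in _ + X <= _]ger0_norm.
  rewrite /slope_const; lra.
exact: addr_ge0.
Qed.

Let source_ge0 : 0 <= source_const.
Proof.
rewrite /source_const /slope_const; have S0 := ltW S_gt0.
by rewrite !addr_ge0// !mulr_ge0// ?exprn_ge0.
Qed.

Let rate_gt0 : 0 < gronwall_rate.
Proof. by rewrite ltr_pwDr// !mulr_ge0// ltW. Qed.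

Lemma interior_const_ge0 : 0 <= interior_const.
Proof. by rewrite /interior_const !mulr_ge0 ?expR_ge0// ltW. Qed.

Lemma exterior_const_ge0 : 0 <= exterior_const.
Proof.
have S0 := ltW S_gt0; have ic0 := interior_const_ge0.
by rewrite /exterior_const addr_ge0// !mulr_ge0// ?exprn_ge0// addr_ge0// mulr_ge0.
Qed.

Let d s := u s - v s.
Let d' s := steady_slope kappa G H u s - steady_slope 0 g0 (cst 0) v s.

Let d_derive s : 0 < s -> is_derive s 1 d (d' s).
Proof.
move=> s0; apply: is_deriveB.
  by have [_ _ /(_ s s0)[_]] := steady_u.
by have [_ _ /(_ s s0)[_]] := steady_v.
Qed.

Let d_continuous a b : 0 <= a -> a < b -> {within `[a, b], continuous d}.
Proof.
move=> a0 ab x; apply: continuousB; first exact: (steady_continuous _ _ _ _ steady_u _ _ a0 ab).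
exact: (steady_continuous _ _ _ _ steady_v _ _ a0 ab).
Qed.

Let d0 : d 0 = 0.
Proof. by rewrite /d; have [-> _ _] := steady_u; have [-> _ _] := steady_v; rewrite subrr. Qed.

(* The maximum [A] of [|u - v| exp(- rate s)] satisfies [A <= const * eps + A / 2]. *)
Lemma steady_dist_interior s : 0 <= s -> s <= S -> `|u s - v s| <= interior_const * eps.
Proof.
set lam := gronwall_rate; have lam0 : 0 < lam by exact: rate_gt0.
pose w s := `|d s| * expR (- (lam * s)).
have S0 := ltW S_gt0; have e0 := eps_ge0; have sc0 := source_ge0.
have cw : {within `[0, S], continuous w}.
  move=> x; apply: (@continuousM R (subspace `[0, S]) (fun s => `|d s|) (fun s => expR (- (lam * s)))).
    by apply: continuous_comp; [exact: d_continuous|exact: norm_continuous].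
  apply: continuous_subspaceT => {}x; apply: continuous_comp; last exact: continuous_expR.
  by apply: continuousN; exact: mulrl_continuous.
have [c] := EVT_max S0 cw; rewrite in_itv/= => /andP[c0 cS] wc.
set A := w c in wc; have A0 : 0 <= A by rewrite mulr_ge0 ?expR_ge0.
have dA t : 0 <= t -> t <= S -> `|d t| <= A * expR (lam * t).
  move=> t0 tS; rewrite -ler_pdivrMr ?expR_gt0// -expRN.
  by apply: wc; rewrite in_itv/= t0.
have step t : 0 < t -> t <= S ->
    `|d t| <= source_const * eps * t + A / 2 * expR (lam * t).
  move=> t0 tS.
  (* A primitive of the bound on the slope difference: the exponential weight reproduces itself
     under integration, with a gain 1 / [lam]. *)
  pose h t := source_const * eps * t + A / 2 * expR (lam * t).
  pose h' t := source_const * eps + A / 2 * (lam * expR (lam * t)).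
  have Dh x : is_derive x 1 h (h' x).
    apply: is_deriveD.
      by rewrite -[X in is_derive _ _ _ X]mulr1; exact: is_derive_cM.
    have De : is_derive x 1 (fun x : R => expR (lam * x)) (lam * expR (lam * x)).
      by apply: is_derive_eq; rewrite /GRing.scale/= mulr1 mulrC.
    exact: is_derive_cM.
  have ch : {within `[0, t], continuous h}.
    by apply: derivable_within_continuous => x _; apply: ex_derive; exact: Dh.
  have dh x : 0 < x < t -> `|d' x| <= h' x.
    move=> /andP[x0 xt]; have xS := le_trans (ltW xt) tS.
    have K y : 0 <= y -> y <= x -> `|G (u y) - g0 (v y)| <= Kg * eps + L * (A * expR (lam * x)).
      move=> y0 yx; apply: (le_trans (density_dist _ y0)); rewrite lerD2l ler_wpM2l//.
      apply: (le_trans (dA _ y0 (le_trans yx xS))); rewrite ler_wpM2l// ler_expR.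
      by rewrite ler_pM2l.
    apply: (le_trans (steady_slope_dist _ _ x0 xS K)).
    have : 0 <= A * expR (lam * x) by rewrite mulr_ge0 ?expR_ge0.
    rewrite /h' (_ : A / 2 * _ = lam / 2 * (A * expR (lam * x))); last by ring.
    set E := A * _; rewrite /lam /gronwall_rate /source_const => E0; nra.
  have := normr_le_increment _ _ _ _ _ _ t0 (d_continuous _ _ (lexx 0) t0) ch _ (fun x _ => Dh x) dh.
  move=> /(_ _)/le_trans; rewrite d0 subr0; apply.
    by move=> x /andP[x0 _]; exact: d_derive.
  by rewrite /h lerBlDr lerDl mulr0 add0r mulr_ge0 ?expR_ge0// divr_ge0.
have Ale : A <= 2 * source_const * S * eps.
  move: c0; rewrite le_eqVlt => /predU1P[c0|c0].
    by rewrite /A /w -c0 d0 normr0 mul0r !mulr_ge0.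
  have := step _ c0 cS.
  have -> : `|d c| = A * expR (lam * c).
    by rewrite /A /w -mulrA -expRD addNr expR0 mulr1.
  have E1 : 1 <= expR (lam * c) by rewrite -expR0 ler_expR mulr_ge0// ltW.
  have := ler_peMr A0 E1.
  have : source_const * eps * c <= source_const * eps * S by rewrite ler_wpM2l// mulr_ge0.
  lra.
move=> s0 sS; apply: (le_trans (dA _ s0 sS)).
rewrite /interior_const -mulrA [expR _ * _]mulrC mulrA.
apply: ler_pM => //.
by rewrite ler_expR ler_pM2l.
Qed.

(** With masses frozen and pressure zero, the slopes differ by at most exterior_const eps / x^2;
    this is integrable at infinity, with integral at most exterior_const eps / S for every end
    point. *)
Lemma steady_dist_exterior s : u S <= 0 -> v S <= 0 -> S <= s ->
  `|u s - v s| <= (interior_const + exterior_const / S) * eps.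
Proof.
move=> uS vS; have S0 := ltW S_gt0; have e0 := eps_ge0; have sc0 := source_ge0.
have ic0 := interior_const_ge0.
have dS : `|d S| <= interior_const * eps by exact: steady_dist_interior.
have ec0 := exterior_const_ge0.
rewrite le_eqVlt => /predU1P[<-|Ss].
  by apply: (le_trans dS); rewrite ler_wpM2r// lerDl divr_ge0.
pose h : R -> R := fun t => - (exterior_const * eps) * t^-1.
pose h' : R -> R := fun t => exterior_const * eps / t ^+ 2.
have Dh x : 0 < x -> is_derive x 1 h (h' x).
  move=> x0; rewrite /h' -[X in is_derive _ _ _ X]mulrNN.
  by apply: is_derive_cM; exact: is_derive_inv.
have ch : {within `[S, s], continuous h}.
  apply: derivable_within_continuous => x; rewrite in_itv/= => /andP[Sx _].
  by have Dx := Dh _ (lt_le_trans S_gt0 Sx); apply: ex_derive.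
have md : `|steady_mass G u S - steady_mass g0 v S| <= 4 * pi * ((Kg + L * interior_const) * eps) * S ^+ 3.
  apply: steady_mass_dist => // t t0 tS; apply: (le_trans (density_dist _ t0)).
  rewrite mulrDl lerD2l -mulrA ler_wpM2l//; exact: steady_dist_interior.
have dh x : S < x < s -> `|d' x| <= h' x.
  move=> /andP[Sx _]; have x0 := lt_trans S_gt0 Sx.
  have mu_x := steady_mass_vacuum _ _ _ _ kappa_ge0 G_ge0 G_npos H_ge0 steady_u _ _ S0 uS (ltW Sx).
  have mv_x : steady_mass g0 v x = steady_mass g0 v S.
    by apply: (steady_mass_vacuum _ _ _ _ (lexx 0) g0_ge0 g0_npos _ steady_v _ _ S0 vS (ltW Sx)).
  have ux : u x <= 0.
    by apply: (le_trans _ uS);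
      apply: (steady_nonincreasing _ _ _ _ kappa_ge0 G_ge0 H_ge0 steady_u _ _ S0 (ltW Sx)).
  rewrite /d' slope_vE /steady_slope mu_x mv_x (H_npos _ ux) mulr0 addr0 /h'.
  have m0 := mass_ge0 S; have ml := mass_le _ S0.
  have cl := compactness_le _ S_gt0 (lexx S).
  set m := steady_mass G u S in md m0 ml cl *; set m' := steady_mass g0 v S in md *.
  (* The mass being constant, the compactness decreases beyond [S], so smallness at [S] suffices. *)
  have cx : kappa * (2 * m / x) <= kappa * (2 * m / S).
    apply: ler_wpM2l => //; apply: ler_wpM2l; first by rewrite mulr_ge0.
    by rewrite lef_pV2 ?posrE// ltW.
  have cx0 : 0 <= kappa * (2 * m / x).
    by apply: mulr_ge0 => //; apply: divr_ge0; [exact: mulr_ge0|exact: ltW].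
  have /(_ _)/andP[|th0 th1] := redshift_dist _ _ cx0 (le_trans cx cl).
    have := kappa_small; lra.
  set th := 1 / _ - 1 in th0 th1.
  rewrite (_ : 1 / _ = 1 + th); last by rewrite /th; ring.
  have x2 : 0 < x ^+ 2 by rewrite exprn_gt0.
  have -> : - (1 + th) * (m / x ^+ 2) - - (m' / x ^+ 2) = - (((m - m') + th * m) / x ^+ 2).
    by ring.
  rewrite normrN normrM [X in _ * X <= _]ger0_norm ?invr_ge0 ?(ltW x2)//.
  rewrite ler_pM2r ?invr_gt0//; apply: (le_trans (ler_normD _ _)).
  rewrite [X in _ + X <= _]ger0_norm; last exact: mulr_ge0.
  have T2 : th * m <= 64 * pi ^+ 2 * density_bound ^+ 2 * S ^+ 5 * eps.
    apply: (@le_trans _ _ ((2 * (8 * pi * density_bound * kappa * S ^+ 2)) *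
      (4 * pi * density_bound * S ^+ 3))).
      exact: ler_pM.
    have -> : (2 * (8 * pi * density_bound * kappa * S ^+ 2)) * (4 * pi * density_bound * S ^+ 3)
      = 64 * pi ^+ 2 * density_bound ^+ 2 * S ^+ 5 * kappa by ring.
    by rewrite ler_wpM2l// !mulr_ge0// ?exprn_ge0.
  rewrite /exterior_const; lra.
have S_s : 0 < s := lt_trans S_gt0 Ss.
have := normr_le_increment _ _ _ _ _ _ Ss (d_continuous _ _ S0 Ss) ch _ _ dh.
move=> /(_ _ _) H1.
have {}H1 : `|d s - d S| <= h s - h S.
  apply: H1 => x /andP[Sx _]; [apply: d_derive|apply: Dh]; exact: lt_trans Sx.
rewrite -/(d s) -(subrK (d S) (d s)); apply: (le_trans (ler_normD _ _)).
have : h s - h S <= exterior_const / S * eps.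
  have : 0 <= exterior_const * eps * s^-1 by rewrite mulr_ge0 ?mulr_ge0// invr_ge0 ltW.
  by rewrite /h; lra.
by move: H1 dS; rewrite mulrDl; lra.
Qed.

End comparison.

(** * Finite radius of the Newtonian steady state *)

Section finite_radius.
Context {R : realType}.
Variables (gamma n : R).
Hypotheses (gamma_gt0 : 0 < gamma) (n_gt1 : 1 < n) (n_lt3 : n < 3).
Variables (g0 : R -> R).
Hypothesis g0_ge0 : forall x, 0 <= g0 x.
Hypothesis g0_homo : forall x y, x <= y -> y <= 1 -> g0 x <= g0 y.
Hypothesis g0E : forall x, 0 < x -> g0 x = gamma * x `^ n.
Implicit Types (s t x c : R).

Definition core_radius := (4 * pi * gamma + 1)^-1.
Definition core_mass := pi / 2 * core_radius ^+ 3 * (gamma * (1 / 2) `^ n).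
(** From v' <= - (pi gamma / 2) s v^n, the derivative of v^(1-n) is at least (n - 1) (pi gamma / 2)
    s; integration halves the coefficient. *)
Definition decay_rate := (n - 1) * (pi * gamma / 4).
(** The second summand is the root S of decay_rate S^2 = (4 S / core_mass)^(n-1), which is solvable
    for S because n < 3. Adding [core_radius] makes the inequality strict and puts the radius
    outside the core. *)
Definition vacuum_radius := core_radius +
  ((4 / core_mass) `^ (n - 1) / decay_rate) `^ (3 - n)^-1.

Lemma core_radius_gt0 : 0 < core_radius.
Proof. by rewrite invr_gt0 ltr_pwDr// !mulr_ge0 ?pi_ge0// ltW. Qed.

Lemma core_mass_gt0 : 0 < core_mass.
Proof.
rewrite !mulr_gt0 ?pi_gt0 ?exprn_gt0 ?core_radius_gt0// ?powR_gt0//; lra.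
Qed.

Lemma decay_rate_gt0 : 0 < decay_rate.
Proof. by rewrite !mulr_gt0 ?pi_gt0// subr_gt0. Qed.

Lemma vacuum_radius_gt0 : 0 < vacuum_radius.
Proof. by rewrite ltr_pwDl ?core_radius_gt0// powR_ge0. Qed.

Variable v : R -> R.
Hypothesis steady_v : steady 0 g0 (cst 0) v.

Let m := steady_mass g0 v.

Let m_ge0 s : 0 <= m s.
Proof. exact: steady_mass_ge0. Qed.

Let v_derive s : 0 < s -> is_derive s 1 v (- (m s / s ^+ 2)).
Proof.
move=> s0; have [_ _ /(_ s s0)[_]] := steady_v.
by rewrite /steady_slope mul0r subr0 divr1 mulN1r !(mulr0, mul0r) addr0.
Qed.

Let v_continuous a b : 0 <= a -> a < b -> {within `[a, b], continuous v}.
Proof. exact: (steady_continuous _ _ _ _ steady_v). Qed.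

Let v_homo s t : 0 <= s -> s <= t -> v t <= v s.
Proof. by apply: (steady_nonincreasing _ _ _ _ (lexx 0) g0_ge0 _ steady_v). Qed.

Let v_le1 s : 0 <= s -> v s <= 1.
Proof. by apply: (steady_le1 _ _ _ _ (lexx 0) g0_ge0 _ steady_v). Qed.

Let m_homo s t : s <= t -> m s <= m t.
Proof. by apply: (steady_mass_homo _ _ _ _ (lexx 0) g0_ge0 g0_homo _ steady_v). Qed.

Let m_ge s : 0 <= s -> pi / 2 * s ^+ 3 * g0 (v s) <= m s.
Proof. by apply: (steady_mass_ge _ _ _ _ (lexx 0) g0_ge0 g0_homo _ steady_v). Qed.

Let m_le s : 0 <= s -> m s <= 4 * pi * gamma * s ^+ 3.
Proof.
have -> : gamma = g0 1 by rewrite g0E// powR1 mulr1.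
by apply: (steady_mass_le _ _ _ _ (lexx 0) g0_ge0 g0_homo _ steady_v).
Qed.

Let v0 : v 0 = 1. Proof. by have [] := steady_v. Qed.

(** On [0, r] the mass bound gives |v'| <= 4 pi gamma r, so the drop is at most 4 pi gamma r^2 = r
    (1 - r) <= 1/4 for r the core radius. *)
Lemma half_on_core : 1 / 2 <= v core_radius.
Proof.
have r0 := core_radius_gt0; set r := core_radius in r0 *.
pose h : R -> R := fun t => 4 * pi * gamma * r * t.
have Dh x : is_derive x 1 h (4 * pi * gamma * r).
  by rewrite -[X in is_derive _ _ _ X]mulr1; exact: is_derive_cM.
have ch : {within `[0, r], continuous h}.
  by apply: derivable_within_continuous => x _; have Dx := Dh x; apply: ex_derive.
have dh x : 0 < x < r -> `|- (m x / x ^+ 2)| <= 4 * pi * gamma * r.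
  move=> /andP[x0 xr]; rewrite normrN ger0_norm; last by rewrite divr_ge0// exprn_ge0// ltW.
  rewrite ler_pdivrMr ?exprn_gt0//; apply: (le_trans (m_le _ (ltW x0))).
  have -> : x ^+ 3 = x * x ^+ 2 by ring.
  rewrite mulrA ler_pM2r ?exprn_gt0// ler_pM2l ?(ltW xr)//.
  by rewrite !mulr_gt0 ?pi_gt0.
have Dv x : 0 < x < r -> is_derive x 1 v (- (m x / x ^+ 2)).
  by move=> /andP[x0 _]; exact: v_derive.
have := normr_le_increment _ _ _ _ _ _ r0 (v_continuous _ _ (lexx 0) r0) ch Dv (fun x _ => Dh x) dh.
rewrite v0 /h mulr0 subr0 ler_norml => /andP[H _].
have g0' := mulr_gt0 (pi_gt0 R) gamma_gt0.
have q1 : (4 * pi * gamma + 1) * r = 1 by rewrite /r mulfV// gt_eqF//; lra.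
nra.
Qed.

Lemma core_mass_le s : core_radius <= s -> core_mass <= m s.
Proof.
move=> rs; apply: le_trans (m_homo _ _ rs).
have r0 := core_radius_gt0; have h2 := half_on_core.
apply: le_trans (m_ge _ (ltW r0)); rewrite /core_mass.
rewrite ler_wpM2l ?mulr_ge0 ?pi_ge0 ?exprn_ge0 ?(ltW r0)//.
have vr : 0 < v core_radius by lra.
rewrite (g0E _ vr) ler_pM2l//; have n1 := n_gt1.
by apply: ge0_ler_powR; rewrite ?nnegrE ?(ltW vr)//; lra.
Qed.

(* [v' <= - c s v^n], hence [v^(1-n)] grows at least quadratically. *)
Lemma steady_decay s : 0 < s -> 0 < v s -> decay_rate * s ^+ 2 <= v s `^ (1 - n).
Proof.
move=> s0 vs.
pose f : R -> R := fun t => decay_rate * t ^+ 2.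
pose h : R -> R := fun t => v t `^ (1 - n).
have vt t : 0 <= t -> t <= s -> 0 < v t by move=> t0 ts; exact: lt_le_trans (v_homo _ _ t0 ts).
pose h' : R -> R := fun t => (1 - n) * v t `^ (1 - n - 1) * - (m t / t ^+ 2).
have Df x : is_derive x 1 f (decay_rate * (2 * x)).
  apply: is_derive_cM; apply: is_derive_eq.
  by rewrite /GRing.scale/= !mulr1; ring.
have cf : {within `[0, s], continuous f}.
  by apply: derivable_within_continuous => x _; have Dx := Df x; apply: ex_derive.
have Dh x : 0 < x < s -> is_derive x 1 h (h' x).
  move=> /andP[x0 xs].
  have Dv := v_derive _ x0.
  have Dp := is_derive1_powR (1 - n) (vt _ (ltW x0) (ltW xs)).
  exact: is_derive1_comp.
have ch : {within `[0, s], continuous h}.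
  have /subspace_continuousP cv := v_continuous _ _ (lexx 0) s0.
  apply/subspace_continuousP => x xs; have := xs; rewrite /= in_itv/= => /andP[x0 xs'].
  have cp : {for v x, continuous (@powR R ^~ (1 - n))}.
    apply/differentiable_continuous/derivable1_diffP.
    by have Dp := is_derive1_powR (1 - n) (vt _ x0 xs'); apply: ex_derive.
  exact: (cvg_comp _ _ (cv x xs) cp).
have fh x : 0 < x < s -> `|decay_rate * (2 * x)| <= h' x.
  move=> /andP[x0 xs]; have vx := vt _ (ltW x0) (ltW xs).
  have d0 := decay_rate_gt0; have n1 := n_gt1.
  rewrite ger0_norm; last by apply: mulr_ge0; [exact: ltW|rewrite mulr_ge0// ltW].
  have := m_ge _ (ltW x0); rewrite (g0E _ vx) => mx.
  have -> : h' x = (n - 1) * v x `^ (- n) * (m x / x ^+ 2).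
    by rewrite /h' (_ : 1 - n - 1 = - n); [ring|ring].
  have pn : v x `^ (- n) * v x `^ n = 1 by rewrite -gt0_powRD// addNr powRr0.
  have -> : decay_rate * (2 * x) = (n - 1) * v x `^ (- n) *
      ((pi / 2 * x ^+ 3 * (gamma * v x `^ n)) / x ^+ 2).
    transitivity ((n - 1) * (v x `^ (- n) * v x `^ n) * (pi / 2 * x * gamma)).
      by rewrite pn /decay_rate; field.
    by field; rewrite gt_eqF.
  apply: ler_wpM2l; first by rewrite mulr_ge0 ?powR_ge0//; lra.
  by rewrite ler_wpM2r// invr_ge0 exprn_ge0// ltW.
have := normr_le_increment _ _ _ _ _ _ s0 cf ch (fun x _ => Df x) Dh fh.
rewrite /f /h v0 powR1 expr0n/= mulr0 subr0 ler_norml => /andP[_]; lra.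
Qed.

(** With S the vacuum radius and q = core_mass / (4 S), decay brings v down to q at S; on [S, 2 S]
    the slope is at most - core_mass / s^2, which costs a further 2 q. *)
Lemma steady_vacuum : v (2 * vacuum_radius) <= - (core_mass / (4 * vacuum_radius)).
Proof.
have S0 := vacuum_radius_gt0; have M0 := core_mass_gt0; have d0 := decay_rate_gt0.
have n1 := n_gt1; have n3 := n_lt3.
have rS : core_radius <= vacuum_radius by rewrite lerDl powR_ge0.
have ST : ((4 / core_mass) `^ (n - 1) / decay_rate) `^ (3 - n)^-1 < vacuum_radius.
  by rewrite ltrDr core_radius_gt0.
set S := vacuum_radius in S0 rS ST *; set M := core_mass in M0 ST *.
(* Otherwise decay_rate S^2 <= v(S)^(1-n) <= (4 S / M)^(n-1), contrary to the choice of S. *)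
have vS : v S <= M / (4 * S).
  rewrite leNgt; apply/negP => qv; set q := M / (4 * S) in qv.
  have q0 : 0 < q by rewrite divr_gt0// mulr_gt0.
  have := steady_decay _ S0 (lt_trans q0 qv).
  apply/negP; rewrite -ltNge.
  have T0 : 0 <= (4 / M) `^ (n - 1) / decay_rate by rewrite divr_ge0 ?powR_ge0// ltW.
  have : (4 / M) `^ (n - 1) / decay_rate < S `^ (3 - n).
    have n3' : 3 - n != 0 by apply/eqP; lra.
    rewrite -[ltLHS]powRr1// -[X in _ `^ X < _](mulVf n3') powRrM.
    by apply: gt0_ltr_powR; rewrite ?nnegrE ?powR_ge0 ?(ltW S0)//; lra.
  rewrite ltr_pdivrMr// => H.
  have qE : q `^ (1 - n) = (4 / M) `^ (n - 1) * S `^ (n - 1).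
    rewrite -powRM ?(ltW S0)//; last by rewrite divr_ge0// ltW.
    rewrite (_ : 1 - n = - (n - 1)); last by ring.
    rewrite powRN -[in LHS]powR_inv1 ?powR_ge0// powRAC.
    congr (_ `^ _); rewrite powR_inv1 ?(ltW q0)// /q; field.
    by rewrite !gt_eqF.
  have : v S `^ (1 - n) <= q `^ (1 - n).
    rewrite (_ : 1 - n = - (n - 1)); last by ring.
    rewrite !powRN lef_pV2 ?posrE ?powR_gt0//; last exact: lt_trans qv.
    have vS0 := lt_trans q0 qv.
    have qn : q \in Num.nneg by rewrite nnegrE ltW.
    have vn : v S \in Num.nneg by rewrite nnegrE ltW.
    have n10 : 0 <= n - 1 by rewrite subr_ge0 ltW.
    exact: (ge0_ler_powR n10 qn vn (ltW qv)).
  move=> /le_lt_trans; apply; rewrite qE.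
  have -> : decay_rate * S ^+ 2 = S `^ (3 - n) * decay_rate * S `^ (n - 1).
    rewrite [RHS]mulrAC -gt0_powRD// (_ : 3 - n + (n - 1) = 2%:R); last by ring.
    by rewrite powR_mulrn ?(ltW S0)// mulrC.
  by rewrite ltr_pM2r ?powR_gt0.
have SS : S < 2 * S by lra.
pose f : R -> R := fun t => - M * t^-1.
have Df x : S < x < 2 * S -> is_derive x 1 f (M * x ^- 2).
  move=> /andP[Sx _]; rewrite -[X in is_derive _ _ _ X]mulrNN.
  by apply: is_derive_cM; apply: is_derive_inv; exact: lt_trans Sx.
have cf : {within `[S, 2 * S], continuous f}.
  apply: derivable_within_continuous => x; rewrite in_itv/= => /andP[Sx _].
  have Dx := is_derive_cM (- M) _ _ _ (is_derive_inv _ (lt_le_trans S0 Sx)).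
  exact: (@ex_derive _ _ _ _ _ _ _ Dx).
pose h : R -> R := fun t => -1 * v t.
have Dh x : S < x < 2 * S -> is_derive x 1 h (-1 * - (m x / x ^+ 2)).
  by move=> /andP[Sx _]; apply: is_derive_cM; apply: v_derive; exact: lt_trans Sx.
have ch : {within `[S, 2 * S], continuous h}.
  move=> x; apply: (@continuousM R (subspace `[S, 2 * S]) (cst (-1)) v).
    exact: cst_continuous.
  exact: (v_continuous _ _ (ltW S0) SS).
have fh x : S < x < 2 * S -> `|M * x ^- 2| <= -1 * - (m x / x ^+ 2).
  move=> /andP[Sx _]; have x0 := lt_trans S0 Sx.
  rewrite mulrNN mul1r ger0_norm; last first.
    by apply: mulr_ge0; [exact: ltW|rewrite invr_ge0 exprn_ge0// ltW].
  rewrite ler_wpM2r ?invr_ge0 ?exprn_ge0 ?(ltW x0)//.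
  by apply: core_mass_le; apply: (le_trans rS); exact: ltW.
have := normr_le_increment _ _ _ _ _ _ SS cf ch Df Dh fh.
rewrite /f /h ler_norml => /andP[_].
have -> : - M * (2 * S)^-1 - - M * S^-1 = 2 * (M / (4 * S)).
  by field; rewrite gt_eqF.
lra.
Qed.

End finite_radius.

(** * Rescaling *)

Section rescaling.
Context {R : realType}.
Local Notation mu := (@lebesgue_measure R).
Local Notation Rint := Defs.Rint.
Implicit Types (r s t x : R).
Variables (Phi : R -> R) (k kappa : R).
Hypotheses (Phi_ge0 : forall eta, 0 <= Phi eta) (kappa_gt0 : 0 < kappa).

Let a := (k + 1 / 2) / 2.
Let n := k + 3 / 2.

(* [g_kappa] and [H_kappa] of the rescaled problem. *)
Definition scaled_g (x : R) : R := kappa `^ (- n) * rel_g Phi (kappa * x).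
Definition scaled_P (x : R) : R := kappa `^ (- (n + 1)) * rel_P Phi (kappa * x).

Lemma scaled_g_ge0 x : 0 <= scaled_g x.
Proof. by rewrite mulr_ge0 ?powR_ge0 ?rel_g_ge0. Qed.

Lemma scaled_P_ge0 x : 0 <= scaled_P x.
Proof. by rewrite mulr_ge0 ?powR_ge0 ?rel_P_ge0. Qed.

Lemma scaled_g_npos x : x <= 0 -> scaled_g x = 0.
Proof. by move=> x0; rewrite /scaled_g /rel_g pmulr_rgt0// ltNge x0 mulr0. Qed.

Lemma scaled_P_npos x : x <= 0 -> scaled_P x = 0.
Proof. by move=> x0; rewrite /scaled_P /rel_P pmulr_rgt0// ltNge x0 mulr0. Qed.

Variable b : R.
Hypothesis rel_g_homo : forall y1 y2, y1 <= y2 -> y2 <= b -> rel_g Phi y1 <= rel_g Phi y2.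
Hypothesis kappa_le : kappa <= b.

Lemma scaled_g_homo x1 x2 : x1 <= x2 -> x2 <= 1 -> scaled_g x1 <= scaled_g x2.
Proof.
move=> x12 x21; apply: ler_wpM2l; first exact: powR_ge0.
apply: rel_g_homo; first by rewrite ler_pM2l.
by apply: le_trans kappa_le; rewrite ger_pMr.
Qed.

Variable y : R -> R.
Hypothesis sol : rel_solution Phi kappa y.

Let c := kappa `^ (- a).
Let u s := kappa^-1 * y (c * s).

Let c_gt0 : 0 < c. Proof. exact: powR_gt0. Qed.

Let y_right : y x @[x --> 0^'+] --> y 0.
Proof. by have [-> [? _]] := sol. Qed.

(** Needed before rescaling: the substitution in the mass integral requires a measurable integrand,
    which monotonicity provides. *)
Lemma rel_nonincreasing s t : 0 <= s -> s <= t -> y t <= y s.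
Proof.
have [_ [_ dy]] := sol; move=> s0 st.
pose dy' r := - (1 / (1 - 2 * rel_mass Phi y r / r)) *
  (rel_mass Phi y r / r ^+ 2 + 4 * pi * r * rel_P Phi (y r)).
have Dy r : 0 < r -> is_derive r 1 y (dy' r) by move=> r0; exact: (dy r r0).2.
apply: (half_line_nonincreasing _ _ _ _ y_right Dy) => // r r0.
have [m1 _] := dy _ r0; have m0 : 0 <= rel_mass Phi y r.
  rewrite /rel_mass !mulr_ge0 ?pi_ge0//; apply: Rintegral_ge0 => x _.
  by apply: mulr_ge0; [exact: sqr_ge0|exact: rel_g_ge0].
rewrite /dy' mulNr oppr_le0 mulr_ge0//.
  by rewrite divr_ge0// subr_ge0 ltW.
apply: addr_ge0; first by rewrite divr_ge0// exprn_ge0// ltW.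
by rewrite mulr_ge0 ?rel_P_ge0// !mulr_ge0 ?pi_ge0// ltW.
Qed.

Let u_nonincreasing s t : 0 <= s -> s <= t -> u t <= u s.
Proof.
move=> s0 st; rewrite ler_pM2l ?invr_gt0//; apply: rel_nonincreasing.
  by rewrite mulr_ge0// ltW.
by rewrite ler_pM2l.
Qed.

Let u0 : u 0 = 1.
Proof. by rewrite /u mulr0; have [-> _] := sol; rewrite mulVf// gt_eqF. Qed.

Let kappa_u s : kappa * u s = y (c * s).
Proof. by rewrite mulrA mulfV ?mul1r// gt_eqF. Qed.

Let scaled_gE x : rel_g Phi (kappa * x) = kappa `^ n * scaled_g x.
Proof. by rewrite /scaled_g mulrA -gt0_powRD// subrr powRr0 mul1r. Qed.

Let scaled_PE x : rel_P Phi (kappa * x) = kappa `^ n * kappa * scaled_P x.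
Proof.
have -> : kappa `^ n * kappa = kappa `^ (n + 1).
  by rewrite gt0_powRD// powRr1// ltW.
by rewrite /scaled_P mulrA -gt0_powRD// subrr powRr0 mul1r.
Qed.

(** This identity dictates a: it says 2 a = n - 1, the exponent for which the mass term of the
    rescaled equation is free of kappa. *)
Let c2_kappa : c ^+ 2 * kappa `^ n = kappa.
Proof.
rewrite expr2 -!gt0_powRD// -[RHS]powRr1 ?(ltW kappa_gt0)//.
by congr (_ `^ _); rewrite /a /n; lra.
Qed.

Lemma rel_massE s : rel_mass Phi y (c * s) = c * kappa * steady_mass scaled_g u s.
Proof.
rewrite /rel_mass Rint_scale//; last 2 first.
- have /integrableP[/measurable_EFinP] :
      mu.-integrable `[0, c * s] (EFin \o (fun t => t ^+ 2 * rel_g Phi (y t))).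
    apply: (@integrable_mass_density _ _ _ kappa).
    + by move=> x; exact: rel_g_ge0.
    + by move=> x1 x2 x12 x2k; apply: rel_g_homo x12 (le_trans x2k kappa_le).
    + exact: rel_nonincreasing.
    + by have [-> _] := sol.
  by [].
- by move=> x _; apply: mulr_ge0; [exact: sqr_ge0|exact: rel_g_ge0].
have -> : Rint 0 s (fun t => (c * t) ^+ 2 * rel_g Phi (y (c * t))) =
    Rint 0 s (fun t => kappa * (t ^+ 2 * scaled_g (u t))).
  congr Rint; apply/funext => t; rewrite -kappa_u scaled_gE.
  by rewrite -[in RHS]c2_kappa; ring.
rewrite /Rint Rintegral_itvZl; first by rewrite /steady_mass /Rint; ring.
apply: (@integrable_mass_density _ _ _ 1).
- exact: scaled_g_ge0.
- exact: scaled_g_homo.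
- exact: u_nonincreasing.
- by rewrite u0.
Qed.

(** Chain rule. By [rel_massE] and [c2_kappa] all powers of kappa cancel in the mass term, while the
    compactness and the pressure term each keep one factor kappa. *)
Lemma steady_rescaled : steady kappa scaled_g scaled_P u.
Proof.
have [_ [yr dy]] := sol; split; first exact: u0.
  have cc : (c * x) @[x --> 0^'+] --> (0 : R)^'+.
    move=> P [e /= e0 He]; exists (e / c); first by rewrite /= divr_gt0.
    move=> x /=; rewrite !sub0r !normrN => xe x0; apply: He => /=; last exact: mulr_gt0.
    by rewrite sub0r normrN normrM (gtr0_norm c_gt0) mulrC -ltr_pdivlMr.
  have : (y (c * x)) @[x --> 0^'+] --> kappa by exact: (cvg_comp _ _ cc yr).
  move=> /(cvgM (cvg_cst kappa^-1)); rewrite mulVf ?gt_eqF//.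
move=> s s0; have cs0 : 0 < c * s by exact: mulr_gt0.
have [] := dy _ cs0; rewrite rel_massE -kappa_u scaled_PE => m1 D.
have k0 := lt0r_neq0 kappa_gt0; have c0 := lt0r_neq0 c_gt0; have s0' := lt0r_neq0 s0.
have mE : 2 * (c * kappa * steady_mass scaled_g u s) / (c * s) =
    kappa * (2 * steady_mass scaled_g u s / s).
  by field; rewrite c0 s0'.
rewrite mE in m1 D; split => //.
have Dc : is_derive s 1 (fun t : R => c * t) c.
  by rewrite -[X in is_derive _ _ _ X]mulr1; exact: is_derive_cM.
have := is_derive_cM kappa^-1 _ _ _ (@is_derive1_comp _ _ _ _ _ _ D Dc).
set X := (X in is_derive _ _ _ X -> _); suff -> : X = steady_slope kappa scaled_g scaled_P u s by [].
rewrite /X /steady_slope; set Q := 1 / _.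
have nE : kappa `^ n = kappa / c ^+ 2 by rewrite -[in RHS]c2_kappa; field.
by rewrite nE; field; rewrite c0 s0' k0.
Qed.

Variables (C A B d : R).
Hypotheses (C_gt0 : 0 < C) (k_gt0 : 0 < k) (d_ge0 : 0 <= d).
Hypotheses (A_ge0 : 0 <= A) (B_ge0 : 0 <= B).

Let pow_le x r : 0 <= r -> 0 < x -> x <= 1 -> (kappa * x) `^ r <= kappa `^ r.
Proof.
move=> r0 x0 x1; apply: ge0_ler_powR => //; rewrite ?nnegrE ?(ltW kappa_gt0)//.
  by rewrite mulr_ge0// ltW.
by rewrite ger_pMr.
Qed.

(** The Newtonian density is homogeneous of degree n, so both densities can be compared at kappa x,
    where the error A (kappa x)^(n+d) leaves kappa^d after division by kappa^n. *)
Lemma scaled_g_dist x :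
  (forall z, 0 < z -> z <= b -> `|rel_g Phi z - newt_g C k z| <= A * z `^ (n + d)) ->
  x <= 1 -> `|scaled_g x - newt_g C k x| <= A * kappa `^ d.
Proof.
move=> gA x1; have [x0|x0] := ltP 0 x; last first.
  by rewrite scaled_g_npos// newt_g_npos// subrr normr0 mulr_ge0 ?powR_ge0.
have kx0 : 0 < kappa * x by exact: mulr_gt0.
have kxb : kappa * x <= b by apply: le_trans kappa_le; rewrite ger_pMr.
have -> : newt_g C k x = kappa `^ (- n) * newt_g C k (kappa * x).
  have nn : kappa `^ (- n) * kappa `^ (k + 3 / 2) = 1.
    by rewrite -gt0_powRD// addNr powRr0.
  rewrite !newt_gE// powRM ?(ltW kappa_gt0) ?(ltW x0)//.
  transitivity ((kappa `^ (- n) * kappa `^ (k + 3 / 2)) * (newt_coef C k * x `^ (k + 3 / 2))).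
    by rewrite nn mul1r.
  by ring.
rewrite -mulrBr normrM ger0_norm ?powR_ge0//.
apply: (@le_trans _ _ (kappa `^ (- n) * (A * kappa `^ (n + d)))).
  rewrite ler_wpM2l ?powR_ge0//; apply: (le_trans (gA _ kx0 kxb)).
  rewrite ler_wpM2l// pow_le//.
  by have k0 := k_gt0; have d0 := d_ge0; rewrite /n; lra.
by rewrite mulrCA -gt0_powRD// addKr.
Qed.

Lemma scaled_P_le x :
  (forall z, 0 < z -> z <= b -> rel_P Phi z <= B * z `^ (n + 1)) ->
  x <= 1 -> scaled_P x <= B.
Proof.
move=> PB x1; have [x0|x0] := ltP 0 x; last by rewrite scaled_P_npos.
have kx0 : 0 < kappa * x by exact: mulr_gt0.
have kxb : kappa * x <= b by apply: le_trans kappa_le; rewrite ger_pMr.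
apply: (@le_trans _ _ (kappa `^ (- (n + 1)) * (B * kappa `^ (n + 1)))).
  rewrite ler_wpM2l ?powR_ge0//; apply: (le_trans (PB _ kx0 kxb)).
  rewrite ler_wpM2l// pow_le//.
  by have k0 := k_gt0; rewrite /n; lra.
by rewrite mulrCA -gt0_powRD// addNr powRr0 mulr1.
Qed.

End rescaling.

(** * Choice of the constants and conclusion *)

Lemma newt_solution_steady (R : realType) (C k : R) (y : R -> R) :
  newt_solution C k y -> steady 0 (newt_g C k) (cst 0) y.
Proof.
move=> [y0 [yr dy]]; split => // s s0; split; first by rewrite mul0r.
have -> : steady_slope 0 (newt_g C k) (cst 0) y s = - (newt_mass C k y s / s ^+ 2).
  by rewrite /steady_slope mul0r subr0 divr1 mulN1r !(mulr0, mul0r) addr0.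
exact: dy.
Qed.

Theorem theorem3p1 (R : realType) (Phi : R -> R) (CPhi k delta : R) :
  measurable_fun setT Phi ->
  (forall eta, 0 <= Phi eta) ->
  (forall eta, eta < 0 -> Phi eta = 0) ->
  0 < k -> k < 3 / 2 -> 0 < delta -> 0 < CPhi ->
  Phi_asymp Phi CPhi k delta ->
  let a := (k + 1 / 2) / 2 in
  exists delta1 C kappa0 : R, 0 < delta1 /\ 0 < C /\ 0 < kappa0 /\
    forall (kappa : R) (y y0 : R -> R),
      0 < kappa -> kappa <= kappa0 ->
      rel_solution Phi kappa y ->
      newt_solution CPhi k y0 ->
      forall s : R, 0 <= s ->
        `| kappa^-1 * y (kappa `^ (- a) * s) - y0 s | <= C * kappa `^ delta1.
Proof.
move=> mPhi Phi_ge0 _ k0 k32 delta0 C0 [M0 [eps [eps0 asympt]]] a.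
pose M := Num.max 0 M0; pose b := Num.min (eps / 2) (1 / 8).
pose d := Num.min delta (1 / 2); pose n := k + 3 / 2.
pose gamma := newt_coef CPhi k.
pose Kg := 4 * pi * (12 * M + 40 * CPhi); pose KH := 4 * pi * (144 * (CPhi + M)).
pose L := gamma * n; pose r := vacuum_radius gamma n; pose S := 2 * r.
pose depth := core_mass gamma n / (4 * r).
pose Ki := interior_const gamma Kg KH L S.
pose Ke := exterior_const gamma Kg KH L S.
have M_ge0 : 0 <= M by rewrite le_max lexx.
have b0 : 0 < b by rewrite lt_min divr_gt0//; lra.
have b8 : b <= 1 / 8 by rewrite ge_min lexx orbT.
have d0 : 0 < d by rewrite lt_min delta0; lra.
have d1 : d <= 1 by rewrite ge_min; apply/orP; right; lra.
have gamma0 : 0 < gamma by exact: newt_coef_gt0.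
have n1 : 1 < n by rewrite /n; lra.
have n3 : n < 3 by rewrite /n; lra.
have n0 : 0 < n := lt_trans ltr01 n1.
have p0 := pi_ge0 R.
have Kg0 : 0 <= Kg by rewrite mulr_ge0 ?mulr_ge0// addr_ge0 ?mulr_ge0// ltW.
have KH0 : 0 <= KH by rewrite mulr_ge0 ?mulr_ge0// addr_ge0// ltW.
have L0 : 0 <= L by rewrite mulr_ge0// ltW.
have r0 : 0 < r by apply: vacuum_radius_gt0.
have S0 : 0 < S by rewrite mulr_gt0.
have depth0 : 0 < depth.
  by apply: divr_gt0; [apply: core_mass_gt0|rewrite mulr_gt0].
have Gamma0 : 0 <= density_bound gamma Kg by apply: addr_ge0 => //; exact: ltW.
have Ki0 : 0 <= Ki by apply: interior_const_ge0 => //; exact: ltW.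
have Ke0 : 0 <= Ke by apply: exterior_const_ge0 => //; exact: ltW.
have Phi_asympt eta : 0 < eta -> eta <= b ->
    `|Phi eta - CPhi * eta `^ k| <= M * eta `^ (k + delta).
  move=> eta0 etab; apply: (le_trans (asympt _ eta0 _)).
    by apply: (le_lt_trans etab); rewrite gt_min; apply/orP; left; lra.
  by rewrite ler_wpM2r ?powR_ge0// le_max lexx orbT.
pose W := 16 * pi * density_bound gamma Kg * S ^+ 2.
have W0 : 0 <= W.
  apply: mulr_ge0; last by rewrite exprn_ge0// ltW.
  by apply: mulr_ge0 => //; exact: mulr_ge0.
pose kappa0 := Num.min (Num.min b (W + 1)^-1) ((depth / (Ki + 1)) `^ d^-1).
have depthKi : 0 < depth / (Ki + 1) by rewrite divr_gt0// ltr_pwDr.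
exists d, (Ki + Ke / S + 1), kappa0; split=> //; split.
  by rewrite ltr_pwDr// addr_ge0// divr_ge0// ltW.
split.
  by rewrite /kappa0 lt_min powR_gt0// andbT lt_min b0 invr_gt0 ltr_pwDr.
move=> kappa y y0 kappa_gt0; rewrite /kappa0 2!le_min => /andP[/andP[kb kW] kd] sol nsol s s0.
pose e := kappa `^ d.
have kappa1 : kappa <= 1 by lra.
have e0 : 0 <= e by exact: powR_ge0.
have ke : kappa <= e.
  by rewrite -[leLHS]powRr1 ?(ltW kappa_gt0)//; apply: ger_powR; rewrite ?kappa_gt0.
have e1 : e <= 1.
  by rewrite -[leRHS](powRr0 kappa); apply: ger_powR; rewrite ?kappa_gt0 ?(ltW d0).
have eKi : Ki * e <= depth.
  have : e <= depth / (Ki + 1).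
    have dK : ((depth / (Ki + 1)) `^ d^-1) `^ d = depth / (Ki + 1).
      by rewrite -powRrM mulVf ?gt_eqF// powRr1// ltW.
    rewrite -[leRHS]dK; apply: ge0_ler_powR => //; rewrite ?nnegrE ?powR_ge0 ?(ltW d0)//.
    exact: ltW.
  rewrite ler_pdivlMr; last by rewrite ltr_pwDr.
  by rewrite mulrDr mulr1; lra.
have kappaW : W * kappa <= 1.
  have : (W + 1) * kappa <= 1.
    by rewrite mulrC -ler_pdivlMr ?div1r// ltr_pwDr.
  by rewrite mulrDl mul1r; lra.
have g_homo := rel_g_nondecreasing _ _ _ _ _ _ mPhi Phi_ge0 C0 k0 delta0 M_ge0 b8 Phi_asympt.
pose G := scaled_g Phi k kappa; pose H := scaled_P Phi k kappa.
pose u t := kappa^-1 * y (kappa `^ (- a) * t).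
have steady_u : steady kappa G H u := steady_rescaled _ _ _ Phi_ge0 kappa_gt0 _ g_homo kb _ sol.
have steady_v := newt_solution_steady _ _ _ _ nsol.
have G_dist x : x <= 1 -> `|G x - newt_g CPhi k x| <= Kg * e.
  move=> x1; apply: (scaled_g_dist _ _ _ kappa_gt0 _ kb) => // [|z z0 zb]; first exact: ltW.
  exact: (rel_g_newt_dist _ _ _ _ _ _ mPhi Phi_ge0 C0 k0 delta0 M_ge0 b8 Phi_asympt).
have H_le x : x <= 1 -> H x <= KH.
  move=> x1; apply: (scaled_P_le _ _ _ kappa_gt0 _ kb) => // z z0 zb.
  rewrite -addrA (_ : 3 / 2 + 1 = 5 / 2); last by lra.
  exact: (rel_P_le _ _ _ _ _ _ mPhi Phi_ge0 C0 k0 delta0 M_ge0 b8 Phi_asympt).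
have G0 x : 0 <= G x := scaled_g_ge0 _ k _ Phi_ge0 x.
have H0 x : 0 <= H x := scaled_P_ge0 _ k _ Phi_ge0 x.
have Gn x : x <= 0 -> G x = 0 := @scaled_g_npos _ Phi k _ kappa_gt0 x.
have Hn x : x <= 0 -> H x = 0 := @scaled_P_npos _ Phi k _ kappa_gt0 x.
have G_homo x1 x2 : x1 <= x2 -> x2 <= 1 -> G x1 <= G x2.
  exact: (scaled_g_homo _ _ _ kappa_gt0 _ g_homo kb).
have g0 := newt_g_ge0 _ k C0 k0.
have gn := newt_g_npos CPhi k.
have gh x1 x2 : x1 <= x2 -> x2 <= 1 -> newt_g CPhi k x1 <= newt_g CPhi k x2.
  by move=> x12 _; exact: newt_g_homo.
have gl := newt_g_lipschitz _ _ C0 k0.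
have dist_i := steady_dist_interior gamma Kg KH L S _ e G H u (newt_g CPhi k) y0
  (ltW gamma0) Kg0 KH0 L0 S0 (ltW kappa_gt0) ke e1 kappaW G0 G_homo H0 H_le
  g0 gh (lexx gamma) gl G_dist steady_u steady_v.
have dist_e := steady_dist_exterior gamma Kg KH L S _ e G H u (newt_g CPhi k) y0
  (ltW gamma0) Kg0 KH0 L0 S0 (ltW kappa_gt0) ke e1 kappaW G0 Gn G_homo H0 Hn H_le
  g0 gn gh (lexx gamma) gl G_dist steady_u steady_v.
have vS : y0 S <= - depth.
  apply: (steady_vacuum _ _ gamma0 n1 n3 _ g0 gh _ _ steady_v) => x x0.
  exact: newt_gE.
have [sS|Ss] := leP s S.
  apply: (le_trans (dist_i s s0 sS)); rewrite -/Ki ler_wpM2r//.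
  by rewrite -addrA lerDl addr_ge0// divr_ge0// ltW.
have vS0 : y0 S <= 0 by lra.
have uS0 : u S <= 0.
  have := dist_i S (ltW S0) (lexx S); rewrite -/Ki ler_norml => /andP[_]; lra.
apply: (le_trans (dist_e s uS0 vS0 (ltW Ss))).
by rewrite -/Ki -/Ke ler_wpM2r// lerDl.
Qed.
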